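(* In the Laguerre I setting of the context, with $a_\rho>-1$ for $1\le\rho\le q$ and $b_h>a_h$ for $1\le h\le r$, let $\boldsymbol\lambda=(\boldsymbol n,\boldsymbol\eta)\in\mathbb N_0^r\times\mathbb N_0^s$ be Laguerre admissible with $c_{\boldsymbol\lambda}\ne0$, assume $\beta_i-\beta_j\notin\mathbb Z$ for $i\ne j$ and $a_\rho-a_\sigma\notin\mathbb Z$ for $\rho\ne\sigma$, and let $\boldsymbol m\in\mathbb N_0^p$ with $|\boldsymbol m|=|\boldsymbol n|+|\boldsymbol\eta|-1$. Let $\mathcal B_{\boldsymbol\lambda,\boldsymbol m}$ be the normalized form defined in the context. Then, for $x>0$, $$\mathcal B_{\boldsymbol\lambda,\boldsymbol m}(x)=\mathscr R_{\boldsymbol\beta,\boldsymbol m}\bigl[w_0(\cdot;\boldsymbol a,\boldsymbol b+\boldsymbol n)\bigr](x)=\bigl(\mathscr R_{\beta_1,m_1}\circ\cdots\circ\mathscr R_{\beta_p,m_p}\bigr)\bigl[w_0(\cdot;\boldsymbol a,\boldsymbol b+\boldsymbol n)\bigr](x).$$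
   Context: Conventions. $(c)_k=c(c+1)\cdots(c+k-1)$. For vectors, $\Gamma(\boldsymbol c)=\prod\Gamma(c_i)$, $(\boldsymbol c)_{\boldsymbol\nu}=\prod(c_i)_{\nu_i}$, $|\boldsymbol\nu|=\sum\nu_i$; $\mathbf 1_d=(1,\dots,1)$; $\boldsymbol e_h$ coordinate vector; $\mathbb P_N$: complex polynomials of degree at most $N$ ($\{0\}$ if $N<0$). $\mathcal M[f](z)=\int_0^\infty x^{z-1}f(x)dx$. Empty products are $1$. Rodrigues operators: $\mathscr R_{\gamma,n}[f](x)=x^{-\gamma}\frac{d^n}{dx^n}\bigl(x^{\gamma+n}f(x)\bigr)$ for $\gamma\in\mathbb R$, $n\in\mathbb N_0$; these commute, and $\mathscr R_{\boldsymbol\gamma,\boldsymbol m}=\mathscr R_{\gamma_1,m_1}\circ\cdots\circ\mathscr R_{\gamma_p,m_p}$. Laguerre I setting. $p\ge1$, $q=r+s$, $r\ge0$, $s\ge1$; $\boldsymbol a\in(-1,\infty)^q$, $\boldsymbol b\in(-1,\infty)^r$, $a_h<b_h$ for $1\le h\le r$; $\boldsymbol\beta\in\mathbb R^p$ with $\beta_i+a_\rho>-1$ for all $i,\rho$. $\mathcal B_{a,b}(x)=x^a(1-x)^{b-a-1}/\Gamma(b-a)$ on $(0,1)$, $0$ elsewhere; $\mathcal G_a(x)=x^ae^{-x}$ on $(0,\infty)$; $(f*g)(x)=\int_0^\infty f(t)g(x/t)dt/t$. $w_0(x;\boldsymbol a,\boldsymbol b)=\mathcal B_{a_1,b_1}*\cdots*\mathcal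 B_{a_r,b_r}*\mathcal G_{a_{r+1}}*\cdots*\mathcal G_{a_q}(x)$; $w_h(x;\boldsymbol a,\boldsymbol b)=w_0(x;\boldsymbol a,\boldsymbol b+\boldsymbol e_h)$, $1\le h\le r$; $v_\ell=\mathscr D^{\ell-1}w_0$, $1\le\ell\le s$, $\mathscr D=-x\frac{d}{dx}$. $\boldsymbol\lambda=(\boldsymbol n,\boldsymbol\eta)$ is Laguerre admissible if all its components differ pairwise by at most one and the components of $\boldsymbol\eta$ are nonincreasing and differ by at most one. $c_{\boldsymbol\lambda}=\prod_{1\le h<j\le r}(b_j-b_h)^{\min(n_h,n_j)}\prod_{j=1}^r\prod_{\rho=1}^q\prod_{u=0}^{n_j-1}(b_j+1-a_\rho)_u$. Normalized form: $\mathcal B_{\boldsymbol\lambda,\boldsymbol m}=\sum_{h=1}^rB^{(h)}w_h+\sum_{\ell=1}^sD^{(\ell)}v_\ell$ with $B^{(h)}\in\mathbb P_{n_h-1}$, $D^{(\ell)}\in\mathbb P_{\eta_\ell-1}$, is the unique such form with $\int_0^\infty\mathcal B_{\boldsymbol\lambda,\boldsymbol m}(x)x^{\beta_i+k}dx=0$ ($1\le i\le p$, $0\le k\le m_i-1$) and $$\mathcal M[\mathcal B_{\boldsymbol\lambda,\boldsymbol m}](z)=\frac{\Gamma(z\mathbf 1_q+\boldsymbol a)}{\Gamma(z\mathbf 1_r+\boldsymbol b+\boldsymbol n)}(\boldsymbol\beta+(1-z)\mathbf 1_p)_{\boldsymbol m}.$$ *)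

(* Defs.v *)
From mathcomp Require Import all_boot all_order all_algebra.
From mathcomp Require Import all_classical all_reals all_analysis.
From mathcomp Require Import complex.

Set Implicit Arguments.
Unset Strict Implicit.
Unset Printing Implicit Defensive.
Import Order.TTheory GRing.Theory Num.Theory.
Import numFieldNormedType.Exports.
Local Open Scope classical_set_scope.
Local Open Scope ring_scope.
Local Open Scope complex_scope.

Definition poch (K : nzRingType) (c : K) (k : nat) : K :=
  \prod_(i < k) (c + (i : nat)%:R).

(* Real integrals are Lebesgue integrals; [Rintegral] is total, and takes a
   conventional value on a function whose integral is not finite. *)
Definition int0y (R : realType) (f : R -> R) : R :=
  \int[lebesgue_measure]_(x in `]0, +oo[) f x.

Definition cint0y (R : realType) (f : R -> R[i]) : R[i] :=
  int0y (fun x => complex.Re (f x)) +i* int0y (fun x => complex.Im (f x)).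

(* x^z = x^(Re z) exp(i (Im z) ln x), meaningful for x > 0 *)
Definition cpow (R : realType) (x : R) (z : R[i]) : R[i] :=
  (x `^ complex.Re z)%:C
  * (cos (complex.Im z * ln x) +i* sin (complex.Im z * ln x)).

Definition mellin (R : realType) (f : R -> R[i]) (z : R[i]) : R[i] :=
  cint0y (fun x => cpow x (z - 1) * f x).

(* Euler's integral, hence the Gamma function only on x > 0, respectively
   Re z > 0; it is never used outside this range. *)
Definition Gammar (R : realType) (x : R) : R :=
  int0y (fun t => t `^ (x - 1) * expR (- t)).

Definition Gammac (R : realType) (z : R[i]) : R[i] :=
  mellin (fun t => (expR (- t))%:C) z.

Definition rodrigues (R : realType) (g : R) (n : nat) (f : R -> R) : R -> R :=
  fun x => x `^ (- g) * derive1n n (fun y => y `^ (g + n%:R) * f y) x.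

(* rodrigues (g 0) (m 0) \o ... \o rodrigues (g (p-1)) (m (p-1)) *)
Definition rodrigues_vec (R : realType) (p : nat) (g : 'I_p -> R)
    (m : 'I_p -> nat) (f : R -> R) : R -> R :=
  foldr (fun i => rodrigues (g i) (m i)) f (enum 'I_p).

Definition beta_kernel (R : realType) (a b : R) : R -> R :=
  fun x => if 0 < x < 1 then x `^ a * (1 - x) `^ (b - a - 1) / Gammar (b - a)
           else 0.

Definition gamma_kernel (R : realType) (a : R) : R -> R :=
  fun x => if 0 < x then x `^ a * expR (- x) else 0.

Definition mconv (R : realType) (f g : R -> R) : R -> R :=
  fun x => int0y (fun t => f t * g (x / t) / t).

(* f1 * (f2 * (... * fk)).  Mellin convolution is associative on nonnegative
   functions as long as the values are allowed to be infinite; with this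
   bracketing, when the last function is a [gamma_kernel] and the others are
   kernels as above, every intermediate convolution is finite on (0, +oo). *)
Fixpoint mconvs (R : realType) (fs : seq (R -> R)) : R -> R :=
  match fs with
  | [::] => fun=> 0
  | f :: gs => if gs is [::] then f else mconv f (mconvs gs)
  end.

Definition w0 (R : realType) (r s : nat) (a : 'I_(r + s) -> R) (b : 'I_r -> R) :
    R -> R :=
  mconvs ([seq beta_kernel (a (lshift s h)) (b h) | h <- enum 'I_r]
          ++ [seq gamma_kernel (a (rshift r l)) | l <- enum 'I_s]).

Definition wh (R : realType) (r s : nat) (a : 'I_(r + s) -> R) (b : 'I_r -> R)
    (h : 'I_r) : R -> R :=
  w0 a (fun j => b j + (j == h)%:R).

(* l is counted from 0: vl a b l is D^l w0, written v_(l+1) in 1-based indexing. *)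
Definition vl (R : realType) (r s : nat) (a : 'I_(r + s) -> R) (b : 'I_r -> R)
    (l : 'I_s) : R -> R :=
  iter l (fun f x => - x * derive1 f x) (w0 a b).

Definition lambda_of (r s : nat) (n : 'I_r -> nat) (eta : 'I_s -> nat) :
    'I_(r + s) -> nat :=
  fun i => match fintype.split i with inl h => n h | inr l => eta l end.

Definition laguerre_admissible (r s : nat) (n : 'I_r -> nat)
    (eta : 'I_s -> nat) : Prop :=
  [/\ forall i j, (lambda_of n eta i <= (lambda_of n eta j).+1)%N,
      forall k l : 'I_s, (k <= l)%N -> (eta l <= eta k)%N
    & forall k l : 'I_s, (eta k <= (eta l).+1)%N].

Definition c_lambda (R : realType) (r s : nat) (a : 'I_(r + s) -> R)
    (b : 'I_r -> R) (n : 'I_r -> nat) : R :=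
  (\prod_(h < r) \prod_(j < r | (h < j)%N) (b j - b h) ^+ minn (n h) (n j))
  * \prod_(j < r) \prod_(rho < r + s) \prod_(u < n j) poch (b j + 1 - a rho) u.

Definition laguerre_form (R : realType) (r s : nat) (a : 'I_(r + s) -> R)
    (b : 'I_r -> R) (B : 'I_r -> {poly R[i]}) (D : 'I_s -> {poly R[i]}) :
    R -> R[i] :=
  fun x => \sum_(h < r) (B h).[x%:C] * (wh a b h x)%:C
         + \sum_(l < s) (D l).[x%:C] * (vl a b l x)%:C.

(* F is, on (0, +oo), a form with the prescribed degrees, orthogonality and
   Mellin transform.  A bound deg P <= N - 1 reads size P <= N, which forces
   P = 0 when N = 0.  The identity of Mellin transforms is required on the
   half-plane where the integrals of the forms converge absolutely; there all
   the arguments of Gamma have positive real part, as a_h < b_h. *)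
Definition normalized_form (R : realType) (p r s : nat) (a : 'I_(r + s) -> R)
    (b : 'I_r -> R) (beta : 'I_p -> R) (n : 'I_r -> nat) (eta : 'I_s -> nat)
    (m : 'I_p -> nat) (F : R -> R[i]) : Prop :=
  [/\ exists (B : 'I_r -> {poly R[i]}) (D : 'I_s -> {poly R[i]}),
        [/\ forall h, (size (B h) <= n h)%N,
            forall l, (size (D l) <= eta l)%N
          & forall x : R, 0 < x -> F x = laguerre_form a b B D x],
      forall (i : 'I_p) (k : nat), (k < m i)%N ->
        cint0y (fun x => F x * (x `^ (beta i + k%:R))%:C) = 0
    & forall z : R[i], (forall rho, 0 < complex.Re z + a rho) ->
        mellin F z =
          (\prod_(rho < r + s) Gammac (z + (a rho)%:C))
          / (\prod_(h < r) Gammac (z + (b h)%:C + (n h)%:R))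
          * \prod_(i < p) poch ((beta i)%:C + 1 - z) (m i)].

(* Main.v *)
(* Two functions that are continuous on (0, oo) and bounded after multiplication
   by x^t for every t > 1 coincide as soon as their Mellin transforms agree on the
   line Re z = 2: with x = exp u, the integrals of psi(exp u) exp u against all
   the exponentials exp(i t u) vanish, hence so do those against the Poisson
   kernels of the line, which concentrate at any given point.  Both sides of the
   claim are of this kind.

   For the right-hand side, raise the last Gamma parameter by j: the functions
   g_j = w_0(. ; a + j e_q, b) satisfy x g_j' = (a_q + j) g_j - g_(j+1), so their
   span is stable under theta = x d/dx.  As M[g_j](z) = (z + a_q)_j M[g_0](z),
   theta multiplies Mellin transforms of elements of the span by -z, with no
   integration by parts, and R_(gamma,n) = prod_(k=1)^n (theta + gamma + k)
   multiplies them by (gamma + 1 - z)_n.  Finally M[g_0] is computed from the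
   convolution theorem and Euler's beta integral; dividing by the Gamma factors
   of b requires that Gamma does not vanish on Re z > 0. *)
Require Import Defs.
From mathcomp Require Import all_boot all_order all_algebra.
From mathcomp Require Import all_classical all_reals all_analysis.
From mathcomp Require Import measurable_realfun.
From mathcomp Require Import complex.
From mathcomp Require Import ring lra.
Set Implicit Arguments.
Unset Strict Implicit.
Unset Printing Implicit Defensive.
Import Order.TTheory GRing.Theory Num.Theory.
Import numFieldNormedType.Exports.
Local Open Scope classical_set_scope.
Local Open Scope ring_scope.
Local Open Scope complex_scope.

(** * Integration on the half-line *)

(** The obstacle is regularity. A beta kernel with b - a < 1 is unbounded near 1, and w_0 is an
    iterated integral without closed form, so every derivative is made to fall on the last Gamma
    kernel, which is smooth on the half-line; s >= 1 guarantees that there is one. Raising its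
    parameter then turns differentiation into algebra on a span.

    Poisson kernels replace an inversion formula, which would ask for integrability of the Mellin
    transforms along the line; here only continuity and integrability of x psi(x) enter. The line Re
    z = 2 is one choice inside Re z > 1, where exponents greater than -1 make all the integrals
    converge absolutely.

    Gamma is shown not to vanish by a direct estimate far to the right, carried back by the
    functional equation. Complex integrals are handled through their real and imaginary parts, and
    functions on the half-line are extended by 0 to the whole line. *)

Section affine_substitution.
Context {R : realType}.
Local Notation mu := (@lebesgue_measure R).
Variables (c d : R) (c_gt0 : 0 < c).

Let phi (x : measurableTypeR R) : measurableTypeR R := c * x + d.

Let measurable_phi : measurable_fun setT phi.
Proof.
by apply: measurable_funD => //; exact: measurable_funM.
Qed.

(** By uniqueness of Lebesgue measure it suffices to compare both measures on half-open intervals,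
    where the preimage has its length divided by c. *)
Lemma lebesgue_measure_affine (A : set (measurableTypeR R)) : measurable A ->
  mu A = (c%:E * mu (phi @^-1` A))%E.
Proof.
have mphi := measurable_phi.
pose k : {nonneg R} := NngNum (ltW c_gt0).
apply: (@lebesgue_measure_unique R (mscale k
  (measure_function_pushforward__canonical__measure_function_Measure mu mphi))) =>
    _ [[u v]] _ <-.
transitivity (c%:E * mu [set` `](u - d)%R / c, (v - d)%R / c]%R])%E; last first.
  apply: (congr1 (fun Z => c%:E * mu Z)%E); apply/seteqP.
  by split=> x /=; rewrite /phi !in_itv/= ltr_pdivrMr// ler_pdivlMr//
    (mulrC x) ltrBlDr lerBrDr.
rewrite !lebesgue_measure_itv/= !lte_fin.
rewrite ltr_pM2r ?invr_gt0// ltrD2r.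
case: ifPn => _; last by rewrite mule0.
rewrite -!EFinB -EFinM; congr EFin.
field; exact: lt0r_neq0.
Qed.

Lemma ge0_integral_affine (f : R -> \bar R) :
  measurable_fun setT f -> (forall x, 0 <= f x)%E ->
  (\int[mu]_x f x = c%:E * \int[mu]_x f (c * x + d)%R)%E.
Proof.
move=> mf f0.
have mphi := measurable_phi.
pose k : {nonneg R} := NngNum (ltW c_gt0).
rewrite (eq_measure_integral (mscale k
  (measure_function_pushforward__canonical__measure_function_Measure mu mphi))); last first.
  by move=> A mA _; exact: lebesgue_measure_affine.
rewrite ge0_integral_mscale//; congr (_ * _)%E.
by rewrite ge0_integral_pushforward.
Qed.

Lemma integrable_affine (f : R -> R) : mu.-integrable setT (EFin \o f) ->
  mu.-integrable setT (EFin \o (fun x => f (c * x + d))).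
Proof.
move=> /integrableP[mf fo]; apply/integrableP; split.
  by apply: (@measurableT_comp _ _ _ _ _ _ (EFin \o f) _ phi).
have mabs : measurable_fun setT (fun x => `|(EFin \o f) x|)%E by exact: measurableT_comp.
rewrite ge0_integral_affine// in fo.
rewrite ltey; apply/negP => /eqP fy; move: fo.
by rewrite [X in (_ * X)%E]fy gt0_muley ?ltxx// lte_fin.
Qed.

Lemma Rintegral_affine (f : R -> R) : mu.-integrable setT (EFin \o f) ->
  \int[mu]_x f x = c * \int[mu]_x f (c * x + d).
Proof.
move=> If; have Ig := integrable_affine If.
have Ef := integrable_funepos measurableT If.
have Ef' := integrable_funeneg measurableT If.
suff E : (\int[mu]_x (f x)%:E = c%:E * \int[mu]_x (f (c * x + d))%:E)%E.
  by rewrite /Rintegral E fineM// integrable_fin_num.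
have mf := measurable_int _ If.
rewrite integralE [in RHS]integralE muleBr//; last first.
  by rewrite integrable_add_def.
rewrite (ge0_integral_affine (measurable_funepos mf))//.
rewrite (ge0_integral_affine (measurable_funeneg mf))//.
by congr (_ * _ - _ * _)%E; apply: eq_integral => x _;
  rewrite ?funeposE ?funenegE.
Qed.

End affine_substitution.

Section positive_half_line.
Context {R : realType}.
Local Notation mu := (@lebesgue_measure R).
Implicit Types f F : R -> R.

(** Such an f is the restriction of itself to an open set on which it is continuous; it may be
    discontinuous, even unbounded, at 0. *)
Lemma measurable_pos f : (forall x : R, x <= 0 -> f x = 0) ->
  (forall x : R, 0 < x -> {for x, continuous f}) -> measurable_fun setT f.
Proof.
move=> f0 cf; have -> : f = f \_ `]0, +oo[.
  apply/funext => x; rewrite patchE; case: ifPn => //.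
  by rewrite notin_setE/= in_itv/= andbT => /negP; rewrite -leNgt => /f0.
apply/(measurable_restrictT _ _).1 => //.
apply: open_continuous_measurable_fun; first exact: interval_open.
by move=> x; rewrite inE/= in_itv/= andbT => x0; exact: cf.
Qed.

(** Always used at [n.+1]: the endpoints 1/(n+2) < n+2 are then distinct, as the fundamental theorem
    of calculus demands. *)
Let A (n : nat) : set R := `[n.+1%:R^-1, n.+1%:R].

Let cvg_patch_exhaust f x : (forall x : R, x <= 0 -> f x = 0) ->
  (f \_ (A n.+1)) x @[n --> \oo] --> f x.
Proof.
move=> f0; have [x0|x0] := leP x 0.
  rewrite f0// [X in X @ _ --> _](_ : _ = cst 0); first exact: cvg_cst.
  by apply/funext => n; rewrite patchE; case: ifP => // _; rewrite f0.
have h (r : R) : \forall n \near \oo, r <= n.+2%:R.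
  by apply: filterS (nbhs_infty_ger r) => k /le_trans; apply;
    rewrite ler_nat ltnW.
apply: cvg_near_cst; near=> n.
rewrite patchE mem_set//= /A/= in_itv/=; apply/andP; split.
  by rewrite invf_ple ?posrE//; near: n; exact: h.
by near: n; exact: h.
Unshelve. all: by end_near. Qed.

Let measurable_exhaust f : measurable_fun setT f -> forall n,
  measurable_fun setT (fun x => ((f \_ (A n.+1)) x)%:E).
Proof.
move=> mf n; have mA : measurable (A n.+1) by exact: measurable_itv.
apply/measurable_EFinP; apply: (measurable_restrictT f mA).1.
by apply: measurable_funS mf.
Qed.

Let continuous_FTC2_exhaust f F n :
  (forall x : R, 0 < x -> is_derive x 1 F (f x)) ->
  (forall x : R, 0 < x -> {for x, continuous f}) ->
  (\int[mu]_x (f \_ (A n.+1) x)%:E = (F n.+2%:R)%:E - (F n.+2%:R^-1)%:E)%E.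
Proof.
move=> dF cf.
have A0 x : x \in A n.+1 -> 0 < x.
  by rewrite inE/= /A/= in_itv/= => /andP[+ _]; apply: lt_le_trans; rewrite invr_gt0.
rewrite -(@continuous_FTC2 _ f F).
- by rewrite [RHS]integral_mkcond; apply: eq_integral => x _; rewrite restrict_EFin.
- by rewrite invf_plt ?posrE// (@lt_trans _ _ 1) ?invf_lt1 ?ltr1n.
- apply: continuous_in_subspaceT => x /A0; exact: cf.
- split.
  + move=> x /subset_itv_oo_cc xA.
    have x0 : 0 < x by apply: A0; rewrite inE.
    by have [] := dF x x0.
  + apply: cvg_at_right_filter.
    have x0 : 0 < n.+2%:R^-1 :> R by rewrite invr_gt0.
    have [dFx _] := dF _ x0.
    by apply: differentiable_continuous; exact/derivable1_diffP.
  + apply: cvg_at_left_filter.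
    have x0 : 0 < n.+2%:R :> R by [].
    have [dFx _] := dF _ x0.
    by apply: differentiable_continuous; exact/derivable1_diffP.
- move=> x /subset_itv_oo_cc xA.
  have x0 : 0 < x by apply: A0; rewrite inE.
  by rewrite derive1E; have [] := dF x x0.
Qed.

(** Fatou's lemma along the exhaustion: each truncated integral is a difference of two values of F,
    hence at most 2M. *)
Lemma integrable_bounded_primitive f F (M : R) :
  (forall x : R, x <= 0 -> f x = 0) -> (forall x : R, 0 < x -> 0 <= f x) ->
  (forall x : R, 0 < x -> is_derive x 1 F (f x)) ->
  (forall x : R, 0 < x -> {for x, continuous f}) ->
  (forall x : R, 0 < x -> `|F x| <= M) ->
  mu.-integrable setT (EFin \o f).
Proof.
move=> f0 fge0 dF cf FM.
have mf := measurable_pos f0 cf.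
have f0' x : 0 <= f x by have [/f0->|/fge0] := leP x 0.
apply/integrableP; split; first exact/measurable_EFinP.
under eq_integral do rewrite /= ger0_norm//.
apply: (@le_lt_trans _ _ (M + M)%:E); last by rewrite ltry.
have fE x : (f x)%:E = limn_einf (fun n => ((f \_ (A n.+1)) x)%:E).
  apply/esym; apply: (cvg_limn_einf_sup _).1.
  apply: cvg_EFin; first exact: nearW.
  exact: cvg_patch_exhaust.
under eq_integral do rewrite fE.
have mA := measurable_exhaust mf.
apply: (le_trans (fatou mu measurableT mA _)).
  by move=> n x _; rewrite lee_fin patchE; case: ifP.
rewrite limn_einf_lim; apply: lime_le; first exact: is_cvg_einfs.
apply: nearW => n; apply: (@le_trans _ _ (\int[mu]_x (f \_ (A n.+1) x)%:E)%E).
  by apply: ereal_inf_lbound; exists n => /=.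
rewrite (continuous_FTC2_exhaust _ dF cf) -EFinB lee_fin.
rewrite (le_trans (ler_norm _))// (le_trans (ler_normB _ _))//.
by rewrite lerD// FM// invr_gt0.
Qed.

(** Dominated convergence along the same exhaustion, with dominating function |f|. *)
Lemma FTC_pos f F (l0 l1 : R) : mu.-integrable setT (EFin \o f) ->
  (forall x : R, x <= 0 -> f x = 0) ->
  (forall x : R, 0 < x -> is_derive x 1 F (f x)) ->
  (forall x : R, 0 < x -> {for x, continuous f}) ->
  F x @[x --> 0^'+] --> l0 -> F x @[x --> +oo] --> l1 ->
  \int[mu]_x f x = l1 - l0.
Proof.
move=> If f0 dF cf Fl0 Fl1.
have mf := measurable_pos f0 cf.
suff : (\int[mu]_x (f x)%:E = (l1 - l0)%:E)%E by rewrite /Rintegral => ->.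
have mA := measurable_exhaust mf.
have := @dominated_cvg _ _ R mu setT measurableT
  (fun n x => ((f \_ (A n.+1)) x)%:E) (EFin \o f) (fun x => `|(EFin \o f) x|)%E mA.
have h1 x : ((f \_ (A n.+1)) x)%:E @[n --> \oo] --> (EFin \o f) x.
  apply: cvg_EFin; first exact: nearW.
  exact: cvg_patch_exhaust.
move=> /(_ (fun x _ => h1 x)).
have h2 x : (`|(EFin \o f) x|)%E \is a fin_num by [].
move=> /(_ (fun x _ => h2 x) (integrable_abse If)).
have h3 n x : (`|((f \_ (A n.+1)) x)%:E| <= `|(EFin \o f) x|)%E.
  by rewrite /= lee_fin patchE; case: ifP => // _; rewrite normr0.
move=> /(_ (fun n x _ => h3 n x)) h4.
apply: (cvg_unique _ h4) => //.
rewrite /= (_ : (fun n => _) = (fun n => (F n.+2%:R - F n.+2%:R^-1)%:E)); last first.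
  by apply/funext => n; rewrite (continuous_FTC2_exhaust _ dF cf) EFinB.
apply: cvg_EFin; first exact: nearW.
apply: cvgB.
  apply: (cvg_comp (fun n : nat => n.+2%:R) F _ Fl1).
  move=> P [M [_ MP]]; apply: filterS (nbhs_infty_ger M) => n Mn; apply: MP.
  by rewrite (le_lt_trans Mn)// ltr_nat ltnW.
apply: (cvg_comp (fun n : nat => n.+2%:R^-1) F _ Fl0).
have h5 : (fun n : nat => n.+2%:R^-1 : R) @ \oo --> (0 : R).
  have := @cvg_harmonic R; rewrite -(cvg_shiftS (@harmonic R)); exact.
move=> P [e /= e0 eP]; have /cvgrPdist_lt/(_ _ e0) := h5.
apply: filterS => n /=.
by move=> ne; apply: eP => //=; rewrite invr_gt0.
Qed.

End positive_half_line.

Local Notation leb := (@lebesgue_measure _).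
Local Notation rint f := (\int[leb]_x f x)%R.

Definition integ (R : realType) (f : R -> R) : Prop :=
  (@lebesgue_measure R).-integrable setT (EFin \o f).

(** With this extension by 0, half-line integrals become integrals over the whole line, where affine
    substitutions and Fubini's theorem need no change of domain. *)
Definition vanish (R : realType) (f : R -> R) : Prop :=
  forall x : R, x <= 0 -> f x = 0.

Definition mellin_integrable (R : realType) (s : R) (f : R -> R) : Prop :=
  integ (fun x => x `^ (s - 1) * f x).

(** Exponents s close to s0 control f near 0, large ones control it at infinity. *)
Definition decays (R : realType) (s0 : R) (f : R -> R) : Prop :=
  forall s : R, s0 < s -> exists C : R, forall x : R, 0 < x -> x `^ s * `|f x| <= C.

(** The Mellin transform of a real function that vanishes on x <= 0, integrated over the whole line;
    see [mellin_of_real]. *)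
Definition rmellin (R : realType) (f : R -> R) (z : R[i]) : R[i] :=
  rint (fun x => complex.Re (cpow x (z - 1)) * f x)
  +i* rint (fun x => complex.Im (cpow x (z - 1)) * f x).

Section real_derivatives.
Context {R : realType}.
Implicit Types (f g : R -> R) (x df dg c : R).

Lemma real_derive_cst c x : is_derive x 1 (fun=> c) (0 : R).
Proof. exact: is_derive_cst. Qed.

Lemma real_deriveD f g x df dg : is_derive x 1 f df -> is_derive x 1 g dg ->
  is_derive x 1 (fun y => f y + g y) (df + dg).
Proof. by move=> hf hg; exact: is_deriveD. Qed.

Lemma real_deriveM f g x df dg : is_derive x 1 f df -> is_derive x 1 g dg ->
  is_derive x 1 (fun y => f y * g y) (df * g x + f x * dg).
Proof.
move=> hf hg; apply: is_derive_eq (is_deriveM hf hg) _.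
by rewrite /GRing.scale/= addrC [g x * _]mulrC.
Qed.

Lemma real_deriveZ c f x df : is_derive x 1 f df -> is_derive x 1 (fun y =>
  c * f y) (c * df).
Proof.
move=> hf; apply: is_derive_eq (real_deriveM (real_derive_cst c x) hf) _.
by rewrite mul0r add0r.
Qed.

Lemma real_deriveV f x df : is_derive x 1 f df -> f x != 0 ->
  is_derive x 1 (fun y => (f y)^-1) (- df / f x ^+ 2).
Proof.
move=> hf fx; apply: is_derive_eq (is_deriveV fx hf) _.
by rewrite /GRing.scale/= !mulNr mulrC.
Qed.

Lemma real_derive_comp f g x df dg : is_derive (g x) 1 f df -> is_derive x 1 g dg ->
  is_derive x 1 (fun y => f (g y)) (df * dg).
Proof.
move=> hf hg; apply: is_derive_eq (is_derive1_comp hf hg) _.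
by [].
Qed.

Lemma near_is_derive f g x df : (\forall y \near x, f y = g y) ->
  is_derive x 1 f df -> is_derive x 1 g df.
Proof.
move=> fg [hf ef]; split.
  by apply: near_eq_derivable hf.
by rewrite -ef; apply/esym; apply: near_eq_derive.
Qed.

Lemma is_derive_continuous f x df : is_derive x 1 f df ->
  {for x, continuous f}.
Proof.
by move=> [fx _]; apply: differentiable_continuous; exact/derivable1_diffP.
Qed.

End real_derivatives.

Section integ.
Context {R : realType}.
Implicit Types (f g : R -> R) (c : R).

Lemma integ_measurable f : integ f -> measurable_fun setT f.
Proof. by move=> /integrableP[/measurable_EFinP]. Qed.

Lemma integD f g : integ f -> integ g -> integ (fun x => f x + g x).
Proof.
move=> If Ig.
have := integrableD measurableT If Ig.
by apply: eq_integrable => //.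
Qed.

Lemma integZ c f : integ f -> integ (fun x => c * f x).
Proof.
move=> If.
have := integrableZl measurableT c If.
by apply: eq_integrable => //.
Qed.

Lemma integN f : integ f -> integ (fun x => - f x).
Proof.
move=> /(integZ (-1)); rewrite (_ : (fun x => -1 * f x) = (fun x => - f x))//.
by apply/funext => x; rewrite mulN1r.
Qed.

Lemma integ_norm f : integ f -> integ (fun x => `|f x|).
Proof. by move=> If; have := integrable_norm If. Qed.

Lemma integ_le f g : measurable_fun setT f -> (forall x, `|f x| <= g x) ->
  integ g -> integ f.
Proof.
move=> mf fg; apply: le_integrable => //; first exact/measurable_EFinP.
by move=> x _; rewrite /= lee_fin (le_trans (fg x))// ler_norm.
Qed.

Lemma rintD f g : integ f -> integ g ->
  rint (fun x => f x + g x) = rint f + rint g.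
Proof. by move=> If Ig; rewrite RintegralD. Qed.

Lemma rintZ c f : integ f -> rint (fun x => c * f x) = c * rint f.
Proof. by move=> If; rewrite RintegralZl. Qed.

Lemma rintB f g : integ f -> integ g ->
  rint (fun x => f x - g x) = rint f - rint g.
Proof. by move=> If Ig; rewrite RintegralB. Qed.

Lemma rint_le f g : integ f -> integ g -> (forall x, f x <= g x) ->
  rint f <= rint g.
Proof. by move=> If Ig fg; apply: le_Rintegral => // x _; exact: fg. Qed.

Lemma rint_indic_itv (a b : R) : a <= b -> rint (\1_(`[a, b]%classic : set R)) = b - a.
Proof.
move=> ab.
have -> : rint (\1_(`[a, b]%classic : set R)) =
    fine (lebesgue_measure (`[a, b]%classic : set R)).
  by rewrite /Rintegral integral_indic// setIT.
rewrite lebesgue_measure_itv/= lte_fin; case: ltP => // ba.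
by apply/eqP; rewrite eq_sym subr_eq0; apply/eqP/le_anti; rewrite ab ba.
Qed.

Lemma int0yE f g : (forall x : R, 0 < x -> f x = g x) -> vanish g ->
  measurable_fun setT g -> int0y f = rint g.
Proof.
move=> fg g0 mg; rewrite /int0y /Rintegral; congr fine.
have fgin : {in `]0, +oo[%classic, g =1 f}.
  by move=> x; rewrite inE/= in_itv/= andbT => /fg.
transitivity (\int[leb]_(x in `]0%R, +oo[) (g x)%:E)%E.
  by apply: eq_integral => x /fgin ->.
rewrite [LHS]integral_mkcond; congr integral; apply/funext => x.
rewrite patchE; case: ifPn => //; rewrite notin_setE/= in_itv/= andbT => /negP.
by rewrite -leNgt => /g0 ->.
Qed.

Lemma powRDp (x r s : R) : 0 < x -> x `^ (r + s) = x `^ r * x `^ s.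
Proof. by move=> x0; rewrite powRD// (gt_eqF x0) implybT. Qed.

(* An explicit integrable majorant, of primitive - 1 / (e (1 + x^e)). *)
Let kern (e : R) (x : R) := if 0 < x then x `^ (e - 1) / (1 + x `^ e) ^+ 2 else 0.

Let continuous_kern e (x : R) : 0 < x -> {for x, continuous (kern e)}.
Proof.
move=> x0.
have h : 1 + x `^ e != 0 by rewrite gt_eqF// ltr_wpDr// powR_ge0.
have d1 := is_derive1_powR e x0.
have d2 := real_deriveD (real_derive_cst 1 x) d1.
have c1 : {for x, continuous (fun y : R => (1 + y `^ e)^-1)}.
  exact: is_derive_continuous (real_deriveV d2 h).
have c2 : {for x, continuous (fun y : R => y `^ (e - 1))}.
  exact: is_derive_continuous (is_derive1_powR (e - 1) x0).
have c3 : {for x, continuous (fun y : R => y `^ (e - 1) * ((1 + y `^ e)^-1 * (1 + y `^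
  e)^-1))}.
  by apply: continuousM => //; exact: continuousM.
have : kern e y @[y --> x] --> x `^ (e - 1) * ((1 + x `^ e)^-1 * (1 + x `^ e)^-1).
  apply: cvg_trans c3; apply: near_eq_cvg; near=> y.
  by rewrite /kern ifT ?exprVn ?invfM ?expr2//; near: y; exact: lt_nbhsr.
rewrite /continuous_at.
by rewrite [X in _ -> _ --> X](_ : _ = x `^ (e - 1) * ((1 + x `^ e)^-1 * (1 + x `^
  e)^-1))// /kern x0 expr2 invfM.
Unshelve. all: by end_near. Qed.

Let integ_kern e : 0 < e -> integ (kern e).
Proof.
move=> e0.
apply: (@integrable_bounded_primitive _ _ (fun x => - e^-1 * (1 + x `^ e)^-1) e^-1).
- by move=> x x0; rewrite /kern ltNge x0.
- by move=> x x0; rewrite /kern x0 divr_ge0 ?sqr_ge0 ?powR_ge0.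
- move=> x x0.
  have h : 1 + x `^ e != 0 by rewrite gt_eqF// ltr_wpDr// powR_ge0.
  have d1 := is_derive1_powR e x0.
  have d2 := real_deriveD (real_derive_cst 1 x) d1.
  apply: is_derive_eq (real_deriveZ (- e^-1) (real_deriveV d2 h)) _.
  rewrite /kern x0; field.
  by rewrite h lt0r_neq0.
- by move=> x; exact: continuous_kern.
- move=> x x0; have h : 0 <= (1 + x `^ e)^-1 by rewrite invr_ge0 addr_ge0 ?powR_ge0.
  have e1 : 0 <= e^-1 by rewrite invr_ge0 ltW.
  rewrite mulNr normrN ger0_norm ?mulr_ge0// ler_piMr//.
  by rewrite invf_le1 ?lerDl ?powR_ge0// ltr_wpDr// powR_ge0.
Qed.

(** Comparison with [kern e]: expanding (1 + x^e)^2 calls for the decay bound at the exponents s -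
    e, s and s + e, and e = (s - s0)/2 keeps the least of them above s0. *)
Lemma decays_mellin_integrable s0 f s : measurable_fun setT f -> vanish f ->
  decays s0 f -> s0 < s -> mellin_integrable s f.
Proof.
move=> mf f0 df s0s.
pose e := (s - s0) / 2.
have e0 : 0 < e by rewrite /e; lra.
have [C1 H1] := df (s - e) ltac:(rewrite /e; lra).
have [C2 H2] := df s s0s.
have [C3 H3] := df (s + e) ltac:(rewrite /e; lra).
apply: (@integ_le _ (fun x => (C1 + C2 *+ 2 + C3) * kern e x)); last first.
  exact/integZ/integ_kern.
- move=> x; rewrite /kern; case: ifPn => [x0|]; last first.
    by rewrite -leNgt => /f0 ->; rewrite !mulr0 normr0.
  rewrite normrM ger0_norm ?powR_ge0//.
  have h : 0 < 1 + x `^ e by rewrite ltr_wpDr// powR_ge0.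
  rewrite mulrA ler_pdivlMr ?exprn_gt0//.
  have -> : x `^ (s - 1) = x `^ (e - 1) * x `^ (s - e).
    by rewrite -powRDp//; congr powR; ring.
  move: (H1 x x0) (H2 x x0) (H3 x x0).
  have -> : x `^ s = x `^ (s - e) * x `^ e.
    by rewrite -powRDp//; congr powR; ring.
  have -> : x `^ (s + e) = x `^ (s - e) * x `^ e * x `^ e.
    by rewrite -!powRDp//; congr powR; ring.
  move=> h1 h2 h3.
  have -> : x `^ (e - 1) * x `^ (s - e) * `|f x| * (1 + x `^ e) ^+ 2 =
    (x `^ (s - e) * `|f x| + (x `^ (s - e) * x `^ e * `|f x|) *+ 2 +
     x `^ (s - e) * x `^ e * x `^ e * `|f x|) * x `^ (e - 1) by ring.
  by rewrite ler_wpM2r ?powR_ge0//; lra.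
- by apply: measurable_funM => //; exact: measurable_powR.
Qed.

End integ.

(** * Mellin transforms *)

Section cpow.
Context {R : realType}.
Implicit Types (x y : R) (z w : R[i]).

Lemma Re_cpow x w : complex.Re (cpow x w) = x `^ complex.Re w * cos (complex.Im w * ln x).
Proof. by rewrite /cpow /= mul0r subr0. Qed.

Lemma Im_cpow x w : complex.Im (cpow x w) = x `^ complex.Re w * sin (complex.Im w * ln x).
Proof. by rewrite /cpow /= mul0r addr0. Qed.

Lemma cpowE x w : cpow x w = (x `^ complex.Re w * cos (complex.Im w * ln x))
  +i* (x `^ complex.Re w * sin (complex.Im w * ln x)).
Proof. by apply/eqP; rewrite eq_complex -Re_cpow -Im_cpow !eqxx. Qed.

Lemma cpowM x y w : 0 < x -> 0 < y -> cpow (x * y) w = cpow x w * cpow y w.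
Proof.
move=> x0 y0; rewrite !cpowE lnM ?posrE// powRM ?ltW// mulrDr cosD sinD.
apply/eqP; rewrite eq_complex /=; apply/andP; split; apply/eqP; ring.
Qed.

Lemma cpowD x z w : 0 < x -> cpow x (z + w) = cpow x z * cpow x w.
Proof.
case: z w => [a b] [c d] x0.
rewrite !cpowE /= powRDp// mulrDl cosD sinD.
apply/eqP; rewrite eq_complex /=; apply/andP; split; apply/eqP; ring.
Qed.

Lemma cpow_real x (r : R) : cpow x r%:C = (x `^ r)%:C.
Proof.
rewrite cpowE /= mul0r cos0 sin0 mulr1 mulr0.
by apply/eqP; rewrite eq_complex /= !eqxx.
Qed.

Lemma norm_Re_cpow x w : `|complex.Re (cpow x w)| <= x `^ complex.Re w.
Proof.
by rewrite Re_cpow normrM ger0_norm ?powR_ge0// ler_piMr ?powR_ge0// cos_max.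
Qed.

Lemma norm_Im_cpow x w : `|complex.Im (cpow x w)| <= x `^ complex.Re w.
Proof.
by rewrite Im_cpow normrM ger0_norm ?powR_ge0// ler_piMr ?powR_ge0// sin_max.
Qed.

Lemma measurable_Re_cpow w : measurable_fun setT (fun x => complex.Re (cpow x w)).
Proof.
under eq_fun do rewrite Re_cpow.
apply: measurable_funM; first exact: measurable_powR.
apply: (@measurableT_comp _ _ _ _ _ _ (@cos R)).
  by apply: continuous_measurable_fun; exact: continuous_cos.
by apply: measurable_funM => //; exact: measurable_ln.
Qed.

Lemma measurable_Im_cpow w : measurable_fun setT (fun x => complex.Im (cpow x w)).
Proof.
under eq_fun do rewrite Im_cpow.
apply: measurable_funM; first exact: measurable_powR.
apply: (@measurableT_comp _ _ _ _ _ _ (@sin R)).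
  by apply: continuous_measurable_fun; exact: continuous_sin.
by apply: measurable_funM => //; exact: measurable_ln.
Qed.

End cpow.

Section rmellin.
Context {R : realType}.
Implicit Types (f g : R -> R) (z : R[i]).

Lemma Re_subr1 z : complex.Re (z - 1) = complex.Re z - 1.
Proof. by rewrite raddfB. Qed.

Lemma norm_Re_cpow_subr1 x z : `|complex.Re (cpow x (z - 1))| <= x `^ (complex.Re z - 1).
Proof. by rewrite -Re_subr1 norm_Re_cpow. Qed.

Lemma norm_Im_cpow_subr1 x z : `|complex.Im (cpow x (z - 1))| <= x `^ (complex.Re z - 1).
Proof. by rewrite -Re_subr1 norm_Im_cpow. Qed.

Lemma mellin_integrable_Re f z : measurable_fun setT f ->
  mellin_integrable (complex.Re z) f ->
  integ (fun x => complex.Re (cpow x (z - 1)) * f x).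
Proof.
move=> mf /integ_norm; apply: integ_le.
  by apply: measurable_funM => //; exact: measurable_Re_cpow.
move=> x; rewrite !normrM ler_wpM2r// (le_trans (norm_Re_cpow _ _))// Re_subr1.
exact: ler_norm.
Qed.

Lemma mellin_integrable_Im f z : measurable_fun setT f ->
  mellin_integrable (complex.Re z) f ->
  integ (fun x => complex.Im (cpow x (z - 1)) * f x).
Proof.
move=> mf /integ_norm; apply: integ_le.
  by apply: measurable_funM => //; exact: measurable_Im_cpow.
move=> x; rewrite !normrM ler_wpM2r// (le_trans (norm_Im_cpow _ _))// Re_subr1.
exact: ler_norm.
Qed.

Lemma rmellinD f g z : measurable_fun setT f -> measurable_fun setT g ->
  mellin_integrable (complex.Re z) f -> mellin_integrable (complex.Re z) g ->
  rmellin (fun x => f x + g x) z = rmellin f z + rmellin g z.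
Proof.
move=> mf mg If Ig; rewrite /rmellin.
under [X in X +i* _]eq_Rintegral do rewrite mulrDr.
under [X in _ +i* X]eq_Rintegral do rewrite mulrDr.
by rewrite !rintD//; [exact: mellin_integrable_Im|exact: mellin_integrable_Im|exact:
  mellin_integrable_Re|exact: mellin_integrable_Re].
Qed.

Lemma rmellinZ c f z : measurable_fun setT f -> mellin_integrable (complex.Re z) f ->
  rmellin (fun x => c * f x) z = c%:C * rmellin f z.
Proof.
move=> mf If; rewrite /rmellin.
under [X in X +i* _]eq_Rintegral do rewrite mulrCA.
under [X in _ +i* X]eq_Rintegral do rewrite mulrCA.
rewrite !rintZ//; [|exact: mellin_integrable_Im|exact: mellin_integrable_Re].
by apply/eqP; rewrite eq_complex /= !mul0r subr0 addr0 !eqxx.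
Qed.

Lemma mellinE (F : R -> R[i]) f g z :
  (forall x : R, 0 < x -> F x = f x +i* g x) ->
  vanish f -> vanish g -> measurable_fun setT f -> measurable_fun setT g ->
  mellin_integrable (complex.Re z) f -> mellin_integrable (complex.Re z) g ->
  mellin F z = rmellin f z + 'i * rmellin g z.
Proof.
move=> FE f0 g0 mf mg If Ig; rewrite /mellin /cint0y.
have IRf := mellin_integrable_Re mf If. have IIf := mellin_integrable_Im mf If.
have IRg := mellin_integrable_Re mg Ig. have IIg := mellin_integrable_Im mg Ig.
rewrite (@int0yE _ _ (fun x => complex.Re (cpow x (z - 1)) * f x -
                    complex.Im (cpow x (z - 1)) * g x)).
- rewrite (@int0yE _ _ (fun x => complex.Im (cpow x (z - 1)) * f x +
                    complex.Re (cpow x (z - 1)) * g x)).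
  + rewrite rintB// rintD// /rmellin.
    by apply/eqP; rewrite eq_complex /=; apply/andP; split; apply/eqP; ring.
  + by move=> x x0; rewrite FE//; case: (cpow _ _) => u v /=; ring.
  + by move=> x x0; rewrite f0// g0// !mulr0 addr0.
  + exact: integ_measurable (integD IIf IRg).
- by move=> x x0; rewrite FE//; case: (cpow _ _) => u v /=; ring.
- by move=> x x0; rewrite f0// g0// !mulr0 subr0.
- exact: integ_measurable (integD IRf (integN IIg)).
Qed.

Lemma mellin_of_real (F : R -> R[i]) f z :
  (forall x : R, 0 < x -> F x = (f x)%:C) -> vanish f -> measurable_fun setT f ->
  mellin_integrable (complex.Re z) f -> mellin F z = rmellin f z.
Proof.
move=> FE f0 mf If.
have I0 : mellin_integrable (complex.Re z) (fun=> 0 : R).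
  rewrite /mellin_integrable; under eq_fun do rewrite mulr0.
  exact: integrable0.
rewrite (@mellinE F f (fun=> 0))//.
rewrite (_ : rmellin (fun=> 0) z = 0) ?mulr0 ?addr0// /rmellin.
under [X in X +i* _]eq_Rintegral do rewrite mulr0.
under [X in _ +i* X]eq_Rintegral do rewrite mulr0.
by rewrite Rintegral_cst// mul0r.
Qed.

End rmellin.

(** * Fubini's theorem and the Mellin transform of a convolution *)

Section fubini.
Context {R : realType}.
Local Notation mu := (@lebesgue_measure R).

(** The inner integrals in Fubini's theorem are finite only almost everywhere; [fine] changes them
    on a null set. *)
Lemma integrable_fine (F : R -> \bar R) : mu.-integrable setT F ->
  integ (fine \o F) /\ (\int[mu]_x (fine (F x))%:E = \int[mu]_x F x)%E.
Proof.
move=> IF; have mF := measurable_int _ IF.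
have mfF : measurable_fun setT (fun x => (fine (F x))%:E).
  by apply/measurable_EFinP; apply: measurableT_comp mF.
have ae : ae_eq mu setT (fun x => (fine (F x))%:E) F.
  have := integrable_ae measurableT IF.
  by apply: filterS => x /= Fx _; rewrite fineK// Fx.
split; last by apply: ae_eq_integral.
rewrite /integ; apply: le_integrable IF => //.
by move=> x _ /=; case: (F x) => [r| |] //=; rewrite ?normr0 ?leey.
Qed.

(** The majorant G gives joint integrability through Tonelli's theorem. The almost everywhere
    conclusion is what later yields the convergence of Euler's beta integral. *)
Lemma fubini_real (h : R -> R -> R) (G : R -> R) :
  measurable_fun setT (fun p : R * R => h p.1 p.2) ->
  (forall y, integ (h ^~ y)) -> integ G ->
  (forall y, rint (fun x => `|h x y|) <= G y) ->
  [/\ integ (fun x => rint (h x)),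
      rint (fun x => rint (h x)) = rint (fun y => rint (h ^~ y)) &
      {ae mu, forall x, integ (h x)}].
Proof.
move=> mh ih iG hG.
pose f (p : R * R) : \bar R := (h p.1 p.2)%:E.
have mf : measurable_fun setT f by apply/measurable_EFinP.
have If : (mu \x mu)%E.-integrable setT f.
  apply/integrable21ltyP => //.
  apply: (@le_lt_trans _ _ (\int[mu]_y (G y)%:E)%E); last exact: integrable_lty iG.
  apply: ge0_le_integral => //.
  - by move=> y _; exact: integral_ge0.
  - apply: (@measurable_fun_fubini_tonelli_G _ _ _ _ _ mu (fun p => `|f p|)%E) => //.
    exact: measurableT_comp.
  - by have /integrableP[] := iG.
  - move=> y _; apply: (@le_trans _ _ (rint (fun x => `|h x y|))%:E);
    last by rewrite lee_fin.
    rewrite /Rintegral fineK//; exact: (integrable_fin_num measurableT (integ_norm (ih y))).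
have IF := integrable_fubini_F If.
have [i1 e1] := integrable_fine IF.
split=> //.
- rewrite {1}/Rintegral e1 /Rintegral; congr fine; rewrite (Fubini If).
  apply: eq_integral => y _; rewrite fineK//.
  exact: (integrable_fin_num measurableT (ih y)).
- exact: ae_integrable1 If.
Qed.

End fubini.

Section mconv.
Context {R : realType}.
Variables (f g : R -> R) (s : R).
Hypotheses (f0 : vanish f) (g0 : vanish g).
Hypotheses (mf : measurable_fun setT f) (mg : measurable_fun setT g).
Hypotheses (fge0 : forall x, 0 <= f x) (gge0 : forall x, 0 <= g x).
Hypotheses (sf : mellin_integrable s f) (sg : mellin_integrable s g).
Hypothesis fin : forall x : R, 0 < x -> integ (fun t => f t * g (x / t) / t).

Let mconv_integrand0 (x t : R) : x <= 0 -> f t * g (x / t) / t = 0.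
Proof.
move=> x0; have [t0|t0] := leP t 0; first by rewrite f0// !mul0r.
by rewrite g0 ?mulr0 ?mul0r// ler_pdivrMr ?mul0r.
Qed.

Lemma mconvE x : mconv f g x = rint (fun t => f t * g (x / t) / t).
Proof.
apply: int0yE => //.
  by move=> t t0; rewrite f0// !mul0r.
have [x0|x0] := leP x 0; last exact: integ_measurable (fin x0).
by under eq_fun do rewrite mconv_integrand0//; exact: measurable_cst.
Qed.

Lemma mconv_vanish : vanish (mconv f g).
Proof.
move=> x x0; rewrite mconvE; under eq_Rintegral do rewrite mconv_integrand0//.
by rewrite Rintegral_cst// mul0r.
Qed.

Lemma mconv_ge0 x : 0 <= mconv f g x.
Proof.
rewrite mconvE; apply: Rintegral_ge0 => t _.
have [t0|t0] := leP t 0; first by rewrite f0// !mul0r.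
by rewrite divr_ge0 ?mulr_ge0// ltW.
Qed.

(** Exchange the integrals and substitute x = t y. The test function phi will be the real or the
    imaginary part of x^(z-1), with s = Re z. *)
Lemma mconv_fubini (phi : R -> R) : measurable_fun setT phi ->
  (forall x, `|phi x| <= x `^ (s - 1)) ->
  rint (fun x => phi x * mconv f g x) =
  rint (fun t => f t * rint (fun y => phi (t * y) * g y)).
Proof.
move=> mphi phile.
pose h (x t : R) := phi x * (f t * g (x / t) / t).
pose M := rint (fun y => y `^ (s - 1) * g y).
(* Inversion of t is written as a power, which is measurable on the whole line; for t <= 0 both
   sides are 0. *)
have hE x t : h x t = phi x * (f t * g (x * t `^ (-1)) * t `^ (-1)).
  rewrite /h; have [t0|t0] := leP t 0; first by rewrite f0// !mul0r !mulr0.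
  by rewrite powR_inv1// ltW.
have mh : measurable_fun setT (fun p : R * R => h p.1 p.2).
  under eq_fun do rewrite hE.
  have mi : measurable_fun setT (fun p : R * R => p.2 `^ (-1)).
    by apply: (@measurableT_comp _ _ _ _ _ _ (fun t => t `^ (-1))) => //;
      exact: measurable_powR.
  apply: measurable_funM; first exact: measurableT_comp.
  apply: measurable_funM => //; apply: measurable_funM; first exact: measurableT_comp.
  by apply: (@measurableT_comp _ _ _ _ _ _ g) => //; exact: measurable_funM.
(* The scaling factor t compensates the 1/t of the measure dt/t. *)
have aff t : 0 < t -> integ (fun x => (x / t) `^ (s - 1) * g (x / t)) /\
    rint (fun x => (x / t) `^ (s - 1) * g (x / t)) = t * M.
  move=> t0; have it0 : 0 < t^-1 by rewrite invr_gt0.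
  have E : (fun x => (x / t) `^ (s - 1) * g (x / t)) =
      (fun x => (t^-1 * x + 0) `^ (s - 1) * g (t^-1 * x + 0)).
    by apply/funext => x; rewrite addr0 (mulrC t^-1).
  rewrite E; split; first exact: (integrable_affine 0 it0 sg).
  rewrite /M (Rintegral_affine 0 it0 sg) mulrA divff ?mul1r//.
  exact: lt0r_neq0.
have hle x t : 0 < t -> `|h x t| <= t `^ (s - 1) * f t / t * ((x / t) `^ (s - 1) * g (x /
  t)).
  move=> t0; rewrite /h normrM.
  have [x0|x0] := leP x 0.
    by rewrite (g0 (x := x / t)) ?ler_pdivrMr ?mul0r// !(mulr0, mul0r) normr0 mulr0.
  rewrite [`|f t * _ / _|]ger0_norm; last by rewrite divr_ge0 ?mulr_ge0// ltW.
  have -> : t `^ (s - 1) * f t / t * ((x / t) `^ (s - 1) * g (x / t)) =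
      (t `^ (s - 1) * (x / t) `^ (s - 1)) * (f t * g (x / t) / t) by ring.
  rewrite -powRM; [|exact: ltW|exact/ltW/divr_gt0].
  rewrite (_ : t * (x / t) = x); last by field; exact: lt0r_neq0.
  rewrite ler_wpM2r//.
  by rewrite divr_ge0 ?mulr_ge0// ltW.
have ih t : integ (h ^~ t).
  have [t0|t0] := leP t 0.
    rewrite (_ : h ^~ t = cst 0); first exact: integrable0.
    by apply/funext => x; rewrite /h f0// !mul0r mulr0.
  apply: integ_le (hle ^~ t ^~ t0) (integZ _ (aff t t0).1).
  apply: measurable_funM => //; apply: measurable_funM => //.
  apply: measurable_funM => //; apply: (@measurableT_comp _ _ _ _ _ _ g) => //.
  exact: measurable_funM.
pose G (t : R) := M * (t `^ (s - 1) * f t).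
have iG : integ G by exact: integZ.
have hG t : rint (fun x => `|h x t|) <= G t.
  have [t0|t0] := leP t 0.
    rewrite /G f0// !mulr0.
    under eq_Rintegral do rewrite /h f0// !mul0r mulr0 normr0.
    by rewrite Rintegral_cst// mul0r.
  apply: le_trans (rint_le (integ_norm (ih t)) (integZ _ (aff t t0).1) (hle ^~ t ^~ t0)) _.
  rewrite rintZ; last exact: (aff t t0).1.
  rewrite (aff t t0).2 /G -mulrA [t^-1 * _]mulrA mulVf ?gt_eqF// mul1r mulrC.
  exact: lexx.
have [_ e1 _] := fubini_real mh ih iG hG.
have inE x : rint (h x) = phi x * mconv f g x.
  have [x0|x0] := leP x 0.
    rewrite mconv_vanish// mulr0.
    under eq_Rintegral do rewrite /h mconv_integrand0// mulr0.
    by rewrite Rintegral_cst// mul0r.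
  by rewrite mconvE /h rintZ//; exact: fin.
transitivity (rint (fun x => rint (h x))).
  by apply: eq_Rintegral => x _; rewrite inE.
rewrite e1; apply: eq_Rintegral => t _.
have [t0|t0] := leP t 0.
  rewrite f0// mul0r; under eq_Rintegral do rewrite /h f0// !mul0r mulr0.
  by rewrite Rintegral_cst// mul0r.
have Iphi : integ (fun y => phi (t * y) * g y).
  apply: (integ_le _ _ (integZ (t `^ (s - 1)) sg)).
    by apply: measurable_funM => //; apply: measurableT_comp => //.
  move=> y; have [y0|y0] := leP y 0; first by rewrite g0// !mulr0 normr0.
  rewrite normrM (ger0_norm (gge0 y)) mulrA -(powRM _ (ltW t0) (ltW y0)).
  by rewrite ler_wpM2r.
rewrite (Rintegral_affine 0 t0 (ih t)) -rintZ; last first.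
  exact: (integrable_affine 0 t0 (ih t)).
rewrite -[RHS]rintZ//.
apply: eq_Rintegral => y _; rewrite addr0 /h [t * y / t]mulrAC divff ?gt_eqF// mul1r.
by field; rewrite gt_eqF.
Qed.

End mconv.

Section mconv_mellin.
Context {R : realType}.
Variables (f g : R -> R).
Hypotheses (f0 : vanish f) (g0 : vanish g).
Hypotheses (mf : measurable_fun setT f) (mg : measurable_fun setT g).
Hypotheses (fge0 : forall x, 0 <= f x) (gge0 : forall x, 0 <= g x).
Hypothesis fin : forall x : R, 0 < x -> integ (fun t => f t * g (x / t) / t).

(** (t y)^(z-1) = t^(z-1) y^(z-1). As the integrals are real, this product is expanded into real and
    imaginary parts, with CR + i CI the transform of g. *)
Lemma rmellin_mconv z : mellin_integrable (complex.Re z) f ->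
  mellin_integrable (complex.Re z) g ->
  rmellin (mconv f g) z = rmellin f z * rmellin g z.
Proof.
move=> sf sg.
have mR := measurable_Re_cpow (z - 1).
have mI := measurable_Im_cpow (z - 1).
have eR := mconv_fubini f0 g0 mf mg fge0 gge0 sf sg fin mR
  (fun x => norm_Re_cpow_subr1 x z).
have eI := mconv_fubini f0 g0 mf mg fge0 gge0 sf sg fin mI
  (fun x => norm_Im_cpow_subr1 x z).
have IfR := mellin_integrable_Re mf sf. have IfI := mellin_integrable_Im mf sf.
have IgR := mellin_integrable_Re mg sg. have IgI := mellin_integrable_Im mg sg.
rewrite /rmellin eR eI.
set CR := rint (fun x => complex.Re (cpow x (z - 1)) * g x).
set CI := rint (fun x => complex.Im (cpow x (z - 1)) * g x).
have e1 t : f t * rint (fun y => complex.Re (cpow (t * y) (z - 1)) * g y) =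
    CR * (complex.Re (cpow t (z - 1)) * f t) - CI * (complex.Im (cpow t (z - 1)) * f t).
  have [t0|t0] := leP t 0; first by rewrite (f0 t0) !(mulr0, mul0r) subr0.
  suff -> : rint (fun y => complex.Re (cpow (t * y) (z - 1)) * g y) =
      complex.Re (cpow t (z - 1)) * CR - complex.Im (cpow t (z - 1)) * CI by ring.
  rewrite -(rintZ _ IgR) -(rintZ _ IgI) -(rintB (integZ _ IgR) (integZ _ IgI)).
  apply: eq_Rintegral => y _; have [y0|y0] := leP y 0.
    by rewrite (g0 y0) !mulr0 subr0.
  rewrite (cpowM _ t0 y0); case: (cpow t _) => a b; case: (cpow y _) => c d /=; ring.
have e2 t : f t * rint (fun y => complex.Im (cpow (t * y) (z - 1)) * g y) =
    CI * (complex.Re (cpow t (z - 1)) * f t) + CR * (complex.Im (cpow t (z - 1)) * f t).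
  have [t0|t0] := leP t 0; first by rewrite (f0 t0) !(mulr0, mul0r) addr0.
  suff -> : rint (fun y => complex.Im (cpow (t * y) (z - 1)) * g y) =
      complex.Re (cpow t (z - 1)) * CI + complex.Im (cpow t (z - 1)) * CR by ring.
  rewrite -(rintZ _ IgI) -(rintZ _ IgR) -(rintD (integZ _ IgI) (integZ _ IgR)).
  apply: eq_Rintegral => y _; have [y0|y0] := leP y 0.
    by rewrite (g0 y0) !mulr0 addr0.
  rewrite (cpowM _ t0 y0); case: (cpow t _) => a b; case: (cpow y _) => c d /=; ring.
under [X in X +i* _]eq_Rintegral do rewrite e1.
under [X in _ +i* X]eq_Rintegral do rewrite e2.
rewrite (rintB (integZ _ IfR) (integZ _ IfI)) (rintD (integZ _ IfR) (integZ _ IfI)).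
rewrite !(rintZ _ IfR) !(rintZ _ IfI).
by apply/eqP; rewrite eq_complex /=; apply/andP; split; apply/eqP; ring.
Qed.

End mconv_mellin.

(** * The Gamma function and Euler's beta integral *)

Section gamma.
Context {R : realType}.
Implicit Types (z : R[i]) (x a s q : R).

Definition exp_kernel (x : R) : R := if 0 < x then expR (- x) else 0.

Lemma exp_kernel_vanish : vanish exp_kernel.
Proof. by move=> x x0; rewrite /exp_kernel ltNge x0. Qed.

Lemma exp_kernelE x : 0 < x -> exp_kernel x = expR (- x).
Proof. by rewrite /exp_kernel => ->. Qed.

Lemma exp_kernel_ge0 x : 0 <= exp_kernel x.
Proof. by rewrite /exp_kernel; case: ifP => // _; exact: expR_ge0. Qed.

Lemma is_derive_exp_kernel x : 0 < x -> is_derive x 1 exp_kernel (- exp_kernel x).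
Proof.
move=> x0; apply: (@near_is_derive _ (fun y => expR (- y))).
  by near=> y; rewrite exp_kernelE//; near: y; exact: lt_nbhsr.
rewrite exp_kernelE//.
apply: is_derive_eq (real_derive_comp (is_derive_expR (- x)) (is_deriveNid x 1)) _.
by rewrite mulrN1.
Unshelve. all: by end_near. Qed.

Lemma exp_kernel_continuous x : 0 < x -> {for x, continuous exp_kernel}.
Proof. by move=> /is_derive_exp_kernel; exact: is_derive_continuous. Qed.

Lemma measurable_exp_kernel : measurable_fun setT exp_kernel.
Proof. exact: measurable_pos exp_kernel_vanish exp_kernel_continuous. Qed.

Lemma powR_expR_bound s : 0 <= s ->
  exists C : R, forall x, 0 < x -> x `^ s * expR (- x) <= C.
Proof.
move=> s0; pose n := (Num.truncn s).+1.
have sn : s <= n%:R by rewrite ltW// truncnS_gt.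
(* The 1 serves x <= 1; for x > 1, x^s <= x^n <= n! exp(x). *)
exists (1 + n`!%:R) => x x0.
have ex : expR (- x) <= 1 by rewrite -expR0 ler_expR oppr_le0 ltW.
have [x1|x1] := leP x 1.
  apply: (@le_trans _ _ 1); last by rewrite lerDl.
  rewrite -[leRHS]mulr1 ler_pM ?powR_ge0 ?expR_ge0//.
  have e1 : 1 `^ s = 1 :> R by rewrite powR1.
  by rewrite -[leRHS]e1 ge0_ler_powR// ?nnegrE// ltW.
apply: (@le_trans _ _ n`!%:R); last by rewrite lerDr.
rewrite expRN ler_pdivrMr ?expR_gt0//.
apply: (@le_trans _ _ (x ^+ n)).
  by rewrite -(powR_mulrn _ (ltW x0)) ler_powR// (ltW x1).
have := expR_ge1Dxn n.-1 (ltW x0).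
rewrite prednK// => h.
rewrite -ler_pdivrMl ?ltr0n ?fact_gt0// mulrC.
by apply: le_trans h; rewrite lerDr.
Qed.

Lemma decays_exp_kernel : decays 0 exp_kernel.
Proof.
move=> s s0; have [C HC] := powR_expR_bound (ltW s0).
exists C => x x0; rewrite exp_kernelE// ger0_norm ?expR_ge0//; exact: HC.
Qed.

Lemma mellin_integrable_exp_kernel s : 0 < s -> mellin_integrable s exp_kernel.
Proof. exact: decays_mellin_integrable measurable_exp_kernel exp_kernel_vanish
  decays_exp_kernel. Qed.

Lemma GammacE z : 0 < complex.Re z -> Gammac z = rmellin exp_kernel z.
Proof.
move=> z0; apply: mellin_of_real exp_kernel_vanish measurable_exp_kernel
  (mellin_integrable_exp_kernel z0).
by move=> x x0; rewrite exp_kernelE.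
Qed.

Lemma GammarE x : 0 < x -> Gammar x = rint (fun t => t `^ (x - 1) * exp_kernel t).
Proof.
move=> x0; apply: int0yE.
- by move=> t t0; rewrite exp_kernelE.
- by move=> t t0; rewrite exp_kernel_vanish// mulr0.
- exact: integ_measurable (mellin_integrable_exp_kernel x0).
Qed.

Lemma Gammac_real x : 0 < x -> Gammac x%:C = (Gammar x)%:C.
Proof.
move=> x0; rewrite GammacE// GammarE// /rmellin.
have e : x%:C - 1 = (x - 1)%:C :> R[i] by rewrite rmorphB.
rewrite e.
under [X in X +i* _]eq_Rintegral do rewrite cpow_real /=.
under [X in _ +i* X]eq_Rintegral do rewrite cpow_real /= mul0r.
by rewrite (Rintegral_cst _ measurableT) mul0r.
Qed.

Lemma Gammar_gt0 x : 0 < x -> 0 < Gammar x.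
Proof.
move=> x0; rewrite GammarE//.
(* A lower bound of the integrand on [1, 2], where t^(x-1) is monotone, increasing or decreasing
   according to the sign of x - 1. *)
pose c := expR (- (2 : R)) * Num.min 1 (2 `^ (x - 1)).
have c0 : 0 < c by rewrite mulr_gt0 ?expR_gt0// lt_min ltr01 powR_gt0.
pose h (t : R) := c * \1_(`[1, 2]%classic : set R) t.
have Ih : integ h by apply: integZ; exact: integrable_indic_itv.
apply: (@lt_le_trans _ _ (rint h)).
  rewrite /h rintZ; last exact: integrable_indic_itv.
  rewrite mulr_gt0//.
  rewrite rint_indic_itv ?ler1n//; lra.
apply: rint_le => //; first exact: mellin_integrable_exp_kernel.
move=> t; rewrite /h indicE; have [t12|t12] := boolP (t \in _); last first.
  by rewrite mulr0 mulr_ge0 ?powR_ge0 ?exp_kernel_ge0.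
move: t12; rewrite inE/= in_itv/= => /andP[t1 t2].
rewrite mulr1 exp_kernelE ?(lt_le_trans _ t1)// /c mulrC ler_pM ?expR_ge0//.
- have [x1|x1] := leP 1 x.
    apply: (@le_trans _ _ 1); first by rewrite ge_min lexx.
    by rewrite -[leLHS](powRr0 t) ler_powR// subr_ge0.
  apply: (@le_trans _ _ (2 `^ (x - 1))); first by rewrite ge_min lexx orbT.
  rewrite -(opprB 1 x) !powRN lef_pV2 ?posrE ?powR_gt0 ?(lt_le_trans _ t1)//.
  by rewrite ge0_ler_powR ?nnegrE// ?subr_ge0 ltW// (lt_le_trans _ t1).
- by rewrite ler_expR lerN2.
Qed.

End gamma.

Section gamma_functional_equation.
Context {R : realType}.
Implicit Types (z : R[i]) (x : R).

Lemma is_derive_Re_cpow z x : 0 < x ->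
  is_derive x 1 (fun y => complex.Re (cpow y z)) (complex.Re (z * cpow x (z - 1))).
Proof.
move=> x0; case: z => a b.
have d1 := is_derive1_powR a x0.
have d2 : is_derive x 1 (fun y => cos (b * ln y)) (- sin (b * ln x) * (b * x^-1)).
  exact: (@real_derive_comp R cos (fun y => b * ln y) x _ _ (is_derive_cos (b * ln x))
    (real_deriveZ b (is_derive1_ln x0))).
have -> : (fun y => complex.Re (cpow y (a +i* b))) = (fun y => y `^ a * cos (b * ln y)).
  by apply/funext => y; rewrite Re_cpow.
apply: is_derive_eq (real_deriveM d1 d2) _.
rewrite cpowE /= subr0 powRDp// powR_inv1 ?ltW//.
by ring.
Qed.

Lemma is_derive_Im_cpow z x : 0 < x ->
  is_derive x 1 (fun y => complex.Im (cpow y z)) (complex.Im (z * cpow x (z - 1))).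
Proof.
move=> x0; case: z => a b.
have d1 := is_derive1_powR a x0.
have d2 : is_derive x 1 (fun y => sin (b * ln y)) (cos (b * ln x) * (b * x^-1)).
  exact: (@real_derive_comp R sin (fun y => b * ln y) x _ _ (is_derive_sin (b * ln x))
    (real_deriveZ b (is_derive1_ln x0))).
have -> : (fun y => complex.Im (cpow y (a +i* b))) = (fun y => y `^ a * sin (b * ln y)).
  by apply/funext => y; rewrite Im_cpow.
apply: is_derive_eq (real_deriveM d1 d2) _.
rewrite cpowE /= subr0 powRDp// powR_inv1 ?ltW//.
by ring.
Qed.

Lemma cvg_invr_pinfty : (x^-1 : R) @[x --> +oo] --> (0 : R).
Proof.
have h : \forall x \near +oo, 0 < (@id R x) by exact: nbhs_pinfty_gt.
exact: (gtr0_cvgV0 h).2 (@cvg_id _ _).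
Qed.

Lemma cvg0_squeeze_pow (F : R -> R) a : 0 < a ->
  (forall x, 0 < x -> `|F x| <= x `^ a * exp_kernel x) ->
  F x @[x --> 0^'+] --> 0 /\ F x @[x --> +oo] --> 0.
Proof.
move=> a0 HF; split; apply: norm_cvg0.
- apply: (@squeeze_cvgr _ _ _ _ (cst 0) (fun x => x `^ a)).
  + near=> x; rewrite normr_ge0/=.
    have x0 : 0 < x by near: x; exact: nbhs_right_gt.
    rewrite (le_trans (HF x x0))// ler_piMr ?powR_ge0// exp_kernelE//.
    by rewrite -expR0 ler_expR oppr_le0 ltW.
  + exact: cvg_cst.
  + exact: powR_cvg0.
- have [C HC] := powR_expR_bound (addr_ge0 (ltW a0) (@ler01 R)).
  apply: (@squeeze_cvgr _ _ _ _ (cst 0) (fun x => C * x^-1)).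
  + near=> x; rewrite normr_ge0/=.
    have x0 : 0 < x by near: x; exact: nbhs_pinfty_gt.
    rewrite (le_trans (HF x x0))// ler_pdivlMr// exp_kernelE//.
    by rewrite -[X in _ * _ * X](powRr1 (ltW x0)) mulrAC -powRDp// HC.
  + exact: cvg_cst.
  + rewrite -(mulr0 C); apply: cvgMr; exact: cvg_invr_pinfty.
Unshelve. all: by end_near. Qed.

(** [dRe] and [dIm] are the real and imaginary parts of the derivative of x^z exp(-x). *)
Let dRe z x := (complex.Re (z * cpow x (z - 1)) - complex.Re (cpow x z)) * exp_kernel x.
Let dIm z x := (complex.Im (z * cpow x (z - 1)) - complex.Im (cpow x z)) * exp_kernel x.

(** Integration by parts: for Re z > 0 the function x^z exp(-x) tends to 0 at both ends, so its
    derivative has integral 0. *)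
Lemma rmellin_exp_kernelS z : 0 < complex.Re z ->
  rmellin exp_kernel (z + 1) = z * rmellin exp_kernel z.
Proof.
move=> z0.
have z1 : 0 < complex.Re (z + 1) by rewrite raddfD/= addr_gt0.
have IR := mellin_integrable_Re (@measurable_exp_kernel R) (mellin_integrable_exp_kernel
  z0).
have II := mellin_integrable_Im (@measurable_exp_kernel R) (mellin_integrable_exp_kernel
  z0).
have IR1 := mellin_integrable_Re (@measurable_exp_kernel R) (mellin_integrable_exp_kernel
  z1).
have II1 := mellin_integrable_Im (@measurable_exp_kernel R) (mellin_integrable_exp_kernel
  z1).
rewrite addrK in IR1 II1.
have ER x : dRe z x = (complex.Re z * (complex.Re (cpow x (z - 1)) * exp_kernel x) -
    complex.Im z * (complex.Im (cpow x (z - 1)) * exp_kernel x)) - complex.Re (cpow x z)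
      * exp_kernel x.
  by rewrite /dRe; case: (z) (cpow x (z - 1)) => a b [c d] /=; ring.
have ER' := funext ER.
have EI x : dIm z x = (complex.Re z * (complex.Im (cpow x (z - 1)) * exp_kernel x) +
    complex.Im z * (complex.Re (cpow x (z - 1)) * exp_kernel x)) - complex.Im (cpow x z)
      * exp_kernel x.
  by rewrite /dIm; case: (z) (cpow x (z - 1)) => a b [c d] /=; ring.
have EI' := funext EI.
have i1 : integ (dRe z).
  rewrite ER'.
  by apply: integD (integN IR1); apply: integD; [exact: integZ|apply: integN;
    exact: integZ].
have i2 : integ (dIm z).
  rewrite EI'.
  by apply: integD (integN II1); apply: integD; exact: integZ.
have dR x : 0 < x -> is_derive x 1 (fun y => complex.Re (cpow y z) * exp_kernel y) (dRe z
  x).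
  move=> x0; apply: is_derive_eq (real_deriveM (is_derive_Re_cpow z x0)
    (is_derive_exp_kernel x0)) _.
  by rewrite /dRe; ring.
have dI x : 0 < x -> is_derive x 1 (fun y => complex.Im (cpow y z) * exp_kernel y) (dIm z
  x).
  move=> x0; apply: is_derive_eq (real_deriveM (is_derive_Im_cpow z x0)
    (is_derive_exp_kernel x0)) _.
  by rewrite /dIm; ring.
have cR w x : 0 < x -> {for x, continuous (fun y => complex.Re (cpow y w))}.
  by move=> x0; exact: is_derive_continuous (is_derive_Re_cpow w x0).
have cI w x : 0 < x -> {for x, continuous (fun y => complex.Im (cpow y w))}.
  by move=> x0; exact: is_derive_continuous (is_derive_Im_cpow w x0).
have cdR x : 0 < x -> {for x, continuous (dRe z)}.
  move=> x0; have ce := exp_kernel_continuous x0.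
  rewrite ER'.
  have h1 := continuousM (cR (z - 1) x x0) ce.
  have h2 := continuousM (cI (z - 1) x x0) ce.
  have h3 := continuousM (cR z x x0) ce.
  have h4 c : {for x, continuous (fun=> c : R)} by exact: cst_continuous.
  exact: (continuousB (continuousB (continuousM (h4 _) h1) (continuousM (h4 _) h2)) h3).
have cdI x : 0 < x -> {for x, continuous (dIm z)}.
  move=> x0; have ce := exp_kernel_continuous x0.
  rewrite EI'.
  have h1 := continuousM (cR (z - 1) x x0) ce.
  have h2 := continuousM (cI (z - 1) x x0) ce.
  have h3 := continuousM (cI z x x0) ce.
  have h4 c : {for x, continuous (fun=> c : R)} by exact: cst_continuous.
  exact: (continuousB (continuousD (continuousM (h4 _) h2) (continuousM (h4 _) h1)) h3).
have [l0 l1] : (fun y => complex.Re (cpow y z) * exp_kernel y) x @[x --> 0^'+] --> 0 /\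
    (fun y => complex.Re (cpow y z) * exp_kernel y) x @[x --> +oo] --> 0.
  apply: (cvg0_squeeze_pow z0) => x x0.
  by rewrite normrM (ger0_norm (exp_kernel_ge0 x)) ler_wpM2r ?exp_kernel_ge0// norm_Re_cpow.
have [l2 l3] : (fun y => complex.Im (cpow y z) * exp_kernel y) x @[x --> 0^'+] --> 0 /\
    (fun y => complex.Im (cpow y z) * exp_kernel y) x @[x --> +oo] --> 0.
  apply: (cvg0_squeeze_pow z0) => x x0.
  by rewrite normrM (ger0_norm (exp_kernel_ge0 x)) ler_wpM2r ?exp_kernel_ge0// norm_Im_cpow.
have v1 : vanish (dRe z) by move=> x x0; rewrite /dRe exp_kernel_vanish// mulr0.
have v2 : vanish (dIm z) by move=> x x0; rewrite /dIm exp_kernel_vanish// mulr0.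
have := FTC_pos i1 v1 dR cdR l0 l1.
have := FTC_pos i2 v2 dI cdI l2 l3.
rewrite ER' EI'.
rewrite subrr rintB//; last by apply: integD; exact: integZ.
rewrite rintD; [|exact: integZ|exact: integZ].
rewrite !rintZ// => /eqP; rewrite subr_eq0 => /eqP eI.
rewrite rintB//; last by apply: integD; [exact: integZ|apply: integN; exact: integZ].
rewrite rintB; [|exact: integZ|exact: integZ].
rewrite !rintZ// => /eqP; rewrite subr_eq0 => /eqP eR.
rewrite /rmellin addrK -eR -eI; case: (z) => a b /=.
by apply/eqP; rewrite eq_complex /=; apply/andP; split; apply/eqP; ring.
Qed.

Lemma Gammac_S z : 0 < complex.Re z -> Gammac (z + 1) = z * Gammac z.
Proof.
move=> z0; rewrite !GammacE//; first exact: rmellin_exp_kernelS.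
by rewrite raddfD/= addr_gt0.
Qed.

Lemma poch_S (K : nzRingType) (c : K) k : poch c k.+1 = poch c k * (c + k%:R).
Proof. by rewrite /poch big_ord_recr. Qed.

Lemma Gammac_poch z k : 0 < complex.Re z -> Gammac (z + k%:R) = poch z k * Gammac z.
Proof.
move=> z0; elim: k => [|k IH]; first by rewrite addr0 /poch big_ord0 mul1r.
rewrite -natr1 addrA Gammac_S; last first.
  rewrite raddfD/= -(rmorph_nat (real_complex R)) /=.
  by rewrite ltr_wpDr.
by rewrite IH poch_S mulrCA mulrA.
Qed.

End gamma_functional_equation.

Section beta.
Context {R : realType}.
Implicit Types (z : R[i]) (x a s q : R).

Definition beta_factor q (t : R) : R := if 0 < t < 1 then (1 - t) `^ (q - 1) else 0.

Lemma beta_factor_vanish q : vanish (beta_factor q).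
Proof. by move=> t t0; rewrite /beta_factor ltNge t0. Qed.

Lemma beta_factor_ge0 q t : 0 <= beta_factor q t.
Proof. by rewrite /beta_factor; case: ifP => // _; exact: powR_ge0. Qed.

Lemma measurable_beta_factor q : measurable_fun setT (beta_factor q).
Proof.
apply: measurable_fun_ifT => //.
  by apply: measurable_and; apply: measurable_fun_ltr.
apply: (@measurableT_comp _ _ _ _ _ _ (fun t : R => t `^ (q - 1)));
  first exact: measurable_powR.
exact: measurable_funB.
Qed.

Variables (q s : R) (q0 : 0 < q) (s0 : 0 < s).

Let G (u : R) := u `^ (q - 1) * exp_kernel u.

Let integG : integ G. Proof. exact: mellin_integrable_exp_kernel. Qed.

(** The two exponentials recombine into exp(-x), free of t: this makes the additive convolution of
    two Gamma integrands a beta integral. *)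
Let GE x t : 0 < x ->
  exp_kernel (x * t) * G (x - x * t) = x `^ (q - 1) * exp_kernel x * beta_factor q t.
Proof.
move=> x0; rewrite /G /beta_factor.
have [t0|t0] := leP t 0.
  by rewrite exp_kernel_vanish ?pmulr_rle0// mul0r mulr0.
have [t1|t1] /= := ltP t 1; last first.
  by rewrite [exp_kernel (x - _)]exp_kernel_vanish ?mulr0// subr_le0 ler_peMr// ltW.
rewrite !exp_kernelE ?mulr_gt0//; last by rewrite subr_gt0 gtr_pMr.
have -> : x - x * t = x * (1 - t) by ring.
rewrite powRM ?ltW// ?subr_gt0//.
have -> : expR (- x) = expR (- (x * t)) * expR (- (x * (1 - t))) by rewrite -expRD;
  congr expR; ring.
ring.
Qed.

(** The integral of an additive convolution is the product of the integrals, and G integrates to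
    Gamma(q). *)
Let beta_fubini (phi : R -> R) : measurable_fun setT phi ->
  (forall x, `|phi x| <= x `^ (s - 1)) ->
  let K x u := (phi u * exp_kernel u) * G (x - u) in
  rint (fun x => rint (K x)) = Gammar q * rint (fun u => phi u * exp_kernel u) /\
  {ae leb, forall x, integ (K x)}.
Proof.
move=> mphi phile K.
have me := @measurable_exp_kernel R.
have mphi1 : measurable_fun setT (fun u => phi u * exp_kernel u) by exact: measurable_funM.
have iphi1 : integ (fun u => phi u * exp_kernel u).
  apply: (integ_le mphi1 _ (mellin_integrable_exp_kernel s0)) => u.
  by rewrite normrM (ger0_norm (exp_kernel_ge0 u)) ler_wpM2r// exp_kernel_ge0.
have mG := integ_measurable integG.
have mK : measurable_fun setT (fun p : R * R => K p.1 p.2).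
  apply: measurable_funM; first exact: (measurableT_comp mphi1).
  by apply: (measurableT_comp mG); exact: measurable_funB.
have aff u : integ (fun x => G (x - u)) /\ rint (fun x => G (x - u)) = Gammar q.
  have e : (fun x => G (x - u)) = (fun x => G (1 * x - u)).
    by apply/funext => x; rewrite mul1r.
  rewrite e; split; first exact: (integrable_affine (- u) ltr01 integG).
  by rewrite (GammarE q0) (Rintegral_affine (- u) ltr01 integG) mul1r.
have iK u : integ (K ^~ u) by apply: integZ; exact: (aff u).1.
have IG : integ (fun u => Gammar q * `|phi u * exp_kernel u|) by apply: integZ;
  exact: integ_norm.
have hG u : rint (fun x => `|K x u|) <= Gammar q * `|phi u * exp_kernel u|.
  rewrite /K (_ : (fun x => _) = (fun x => `|phi u * exp_kernel u| * G (x - u))).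
    rewrite rintZ; last exact: (aff u).1.
    by rewrite (aff u).2 mulrC.
  apply/funext => x; rewrite normrM; congr (_ * _).
  by rewrite ger0_norm// mulr_ge0 ?powR_ge0 ?exp_kernel_ge0.
have [_ e1 ae1] := fubini_real mK iK IG hG.
split; last exact: ae1.
rewrite e1 -(rintZ _ iphi1); apply: eq_Rintegral => u _.
rewrite /K rintZ; last exact: (aff u).1.
by rewrite (aff u).2 mulrC.
Qed.

(* By Fubini's theorem the convolution integral of x^(s-1) exp(-x) with
   x^(q-1) exp(-x) converges at some x > 0; scaling by x gives Euler's integral. *)
Lemma mellin_integrable_beta_factor : mellin_integrable s (beta_factor q).
Proof.
have [||_ [N [mN N0 subN]]] := @beta_fubini (fun x => x `^ (s - 1)).
- exact: measurable_powR.
- by move=> x; rewrite ger0_norm ?powR_ge0.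
have [x [x0 ix]] : exists x, 0 < x /\
    integ (fun u => (u `^ (s - 1) * exp_kernel u) * G (x - u)).
  apply: contrapT => /forallNP nex.
  (* Otherwise the exceptional null set N would contain [1, 2], of measure 1. *)
  have : ((@lebesgue_measure R) (`[1%R, 2%R]%classic : set R) <= (@lebesgue_measure R) N)%E.
    apply: le_measure; rewrite ?inE//.
    move=> x /= /[!in_itv]/= /andP[x1 x2]; apply: subN => /= ix.
    by apply: (nex x); split => //; exact: lt_le_trans x1.
  rewrite N0 lebesgue_measure_itv/= lte_fin ltr1n -EFinB lee_fin leNgt subr_gt0 ltr1n.
  by move=> /negP h; exact: h.
have := integrable_affine 0 x0 ix.
have x1 : x `^ (s - 1) * (x `^ (q - 1) * exp_kernel x) != 0.
  by rewrite exp_kernelE// !mulf_neq0 ?gt_eqF ?powR_gt0 ?expR_gt0.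
move=> /(integZ (x `^ (s - 1) * (x `^ (q - 1) * exp_kernel x))^-1).
rewrite /mellin_integrable; congr integ; apply/funext => t; rewrite addr0 -mulrA GE//.
have [t0|t0] := leP t 0; first by rewrite beta_factor_vanish// !mulr0.
rewrite powRM ?ltW//; field.
by move: x1; rewrite !mulf_eq0 !negb_or => /andP[-> /andP[-> ->]].
Qed.

(** Substitute u = x t: [GE] contributes x^(q-1) exp(-x), and the scaling one more factor x. *)
Let beta_inner (phi : R -> R) x : measurable_fun setT phi ->
  (forall x, `|phi x| <= x `^ (s - 1)) -> 0 < x ->
  rint (fun u => (phi u * exp_kernel u) * G (x - u)) =
  x `^ q * exp_kernel x * rint (fun t => phi (x * t) * beta_factor q t).
Proof.
move=> mphi phile x0.
have i1 : integ (fun t => phi (x * t) * beta_factor q t).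
  apply: (integ_le _ _ (integZ (x `^ (s - 1)) mellin_integrable_beta_factor)).
    apply: measurable_funM; last exact: measurable_beta_factor.
    by apply: (measurableT_comp mphi); exact: measurable_funM.
  move=> t; have [t0|t0] := leP t 0; first by rewrite beta_factor_vanish// !mulr0 normr0.
  rewrite normrM (ger0_norm (beta_factor_ge0 q t)) mulrA -(powRM _ (ltW x0) (ltW t0)).
  by rewrite ler_wpM2r ?beta_factor_ge0.
pose H t := (phi (x * t) * exp_kernel (x * t)) * G (x - x * t).
have HE t : H t = x `^ (q - 1) * exp_kernel x * (phi (x * t) * beta_factor q t).
  by rewrite /H -mulrA GE//; ring.
have iH : integ H by rewrite (funext HE); exact: integZ.
have xi : 0 < x^-1 by rewrite invr_gt0.
have xx : x != 0 by rewrite gt_eqF.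
have e : (fun u => (phi u * exp_kernel u) * G (x - u)) = (fun u => H (x^-1 * u + 0)).
  by apply/funext => u; rewrite /H addr0 mulVKf.
have := Rintegral_affine 0 xi iH; rewrite -e (funext HE) rintZ// => h.
have -> : x `^ q = x * x `^ (q - 1) by rewrite mulr_powRB1// ltW.
by rewrite -!mulrA (mulrA (x `^ (q - 1))) h mulVKf.
Qed.

(** Integrate the additive convolution of u^(z-1) exp(-u) and u^(q-1) exp(-u) in two ways: Fubini
    gives the left-hand side, while at each x > 0 the convolution is x^(z+q-1) exp(-x) times the
    beta integral. *)
Lemma beta_integral z : complex.Re z = s ->
  Gammac z * (Gammar q)%:C = Gammac (z + q%:C) * rmellin (beta_factor q) z.
Proof.
move=> zs; have z0 : 0 < complex.Re z by rewrite zs.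
have zq0 : 0 < complex.Re (z + q%:C) by rewrite raddfD/= addr_gt0.
rewrite !GammacE//.
have sb : mellin_integrable (complex.Re z) (beta_factor q) by rewrite zs;
  exact: mellin_integrable_beta_factor.
have bR := mellin_integrable_Re (measurable_beta_factor q) sb.
have bI := mellin_integrable_Im (measurable_beta_factor q) sb.
have IR := mellin_integrable_Re (@measurable_exp_kernel R) (mellin_integrable_exp_kernel
  zq0).
have II := mellin_integrable_Im (@measurable_exp_kernel R) (mellin_integrable_exp_kernel
  zq0).
set BR := rint (fun x => complex.Re (cpow x (z - 1)) * beta_factor q x) in bR *.
set BI := rint (fun x => complex.Im (cpow x (z - 1)) * beta_factor q x) in bI *.
have cq x : 0 < x -> cpow x (z + q%:C - 1) = (x `^ q)%:C * cpow x (z - 1).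
  by move=> x0; rewrite -cpow_real -cpowD//; congr cpow; rewrite addrAC addrC.
have leR x : `|complex.Re (cpow x (z - 1))| <= x `^ (s - 1).
  by rewrite -zs norm_Re_cpow_subr1.
have leI x : `|complex.Im (cpow x (z - 1))| <= x `^ (s - 1).
  by rewrite -zs norm_Im_cpow_subr1.
have mR := measurable_Re_cpow (z - 1). have mI := measurable_Im_cpow (z - 1).
have inner0 x (phi : R -> R) : x <= 0 -> rint (fun u =>
  (phi u * exp_kernel u) * G (x - u)) = 0.
  move=> x0; rewrite (_ : (fun u => _) = cst 0) ?(Rintegral_cst _ measurableT) ?mul0r//.
  apply/funext => u; have [u0|u0] := leP u 0; first by rewrite (exp_kernel_vanish u0)
    mulr0 mul0r.
  have xu : x - u <= 0 by rewrite subr_le0 (le_trans x0)// ltW.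
  by rewrite /G (exp_kernel_vanish xu) !mulr0.
have [eR _] := beta_fubini mR leR.
have [eI _] := beta_fubini mI leI.
have inR x : rint (fun u => (complex.Re (cpow u (z - 1)) * exp_kernel u) * G (x - u)) =
    BR * (complex.Re (cpow x (z + q%:C - 1)) * exp_kernel x) -
    BI * (complex.Im (cpow x (z + q%:C - 1)) * exp_kernel x).
  have [x0|x0] := leP x 0.
    rewrite (exp_kernel_vanish x0) !mulr0 subr0.
    exact: inner0.
  rewrite (beta_inner mR leR x0).
  have -> : rint (fun t => complex.Re (cpow (x * t) (z - 1)) * beta_factor q t) =
      complex.Re (cpow x (z - 1)) * BR - complex.Im (cpow x (z - 1)) * BI.
    rewrite -(rintZ _ bR) -(rintZ _ bI) -(rintB (integZ _ bR) (integZ _ bI)).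
    apply: eq_Rintegral => t _; have [t0|t0] := leP t 0.
      by rewrite (beta_factor_vanish _ t0) !mulr0 subr0.
    by rewrite (cpowM _ x0 t0); case: (cpow x _) => a b; case: (cpow t _) => c d /=; ring.
  by rewrite (cq x x0); case: (cpow x _) => c d /=; ring.
have inI x : rint (fun u => (complex.Im (cpow u (z - 1)) * exp_kernel u) * G (x - u)) =
    BI * (complex.Re (cpow x (z + q%:C - 1)) * exp_kernel x) +
    BR * (complex.Im (cpow x (z + q%:C - 1)) * exp_kernel x).
  have [x0|x0] := leP x 0.
    rewrite (exp_kernel_vanish x0) !mulr0 addr0.
    exact: inner0.
  rewrite (beta_inner mI leI x0).
  have -> : rint (fun t => complex.Im (cpow (x * t) (z - 1)) * beta_factor q t) =
      complex.Re (cpow x (z - 1)) * BI + complex.Im (cpow x (z - 1)) * BR.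
    rewrite -(rintZ _ bI) -(rintZ _ bR) -(rintD (integZ _ bI) (integZ _ bR)).
    apply: eq_Rintegral => t _; have [t0|t0] := leP t 0.
      by rewrite (beta_factor_vanish _ t0) !mulr0 addr0.
    by rewrite (cpowM _ x0 t0); case: (cpow x _) => a b; case: (cpow t _) => c d /=; ring.
  by rewrite (cq x x0); case: (cpow x _) => c d /=; ring.
move: eR eI; rewrite (funext inR) (funext inI).
rewrite (rintB (integZ _ IR) (integZ _ II)) (rintD (integZ _ IR) (integZ _ II)).
rewrite !(rintZ _ IR) !(rintZ _ II) => eR eI.
rewrite /rmellin -/BR -/BI.
apply/eqP; rewrite eq_complex /=; apply/andP; split; apply/eqP.
  by rewrite mulr0 subr0 mulrC -eR; ring.
by rewrite mulr0 add0r mulrC -eI; ring.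
Qed.

End beta.

(** * Nonvanishing of the Gamma function on the right half-plane *)

Section elementary_bounds.
Context {R : realType}.
Implicit Types x u : R.

Lemma sin_le_id x : 0 <= x -> `|sin x| <= x.
Proof.
rewrite le_eqVlt => /predU1P[<-|x0]; first by rewrite sin0 normr0.
have d y : y \in `]0, x[ -> is_derive y 1 sin (cos y) by move=> _; exact: is_derive_sin.
have cs : {within `[0, x], continuous (@sin R)}.
  by apply: continuous_subspaceT => y; exact: continuous_sin.
have [c _] := MVT x0 d cs.
rewrite sin0 !subr0 => ->.
by rewrite normrM (gtr0_norm x0) ler_piMl ?cos_max// ltW.
Qed.

(** cos x = 1 - 2 sin^2(x/2), and |sin v| <= v for v >= 0. *)
Lemma cos_ge_quadratic x : 1 - x ^+ 2 / 2 <= cos x.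
Proof.
wlog x0 : x / 0 <= x => [h|].
  have [|x0] := leP 0 x; first exact: h.
  by rewrite -cosN -sqrrN h// oppr_ge0 ltW.
have -> : cos x = 1 - sin (x / 2) ^+ 2 *+ 2.
  have -> : cos x = cos (x / 2 + x / 2) by congr cos; field.
  by rewrite cosD; have := cos2Dsin2 (x / 2); lra.
have h : `|sin (x / 2)| <= x / 2 by apply: sin_le_id; rewrite divr_ge0.
have : sin (x / 2) ^+ 2 <= (x / 2) ^+ 2.
  by rewrite -[leLHS]real_normK ?num_real// lerXn2r// nnegrE// divr_ge0.
have -> : (x / 2) ^+ 2 = x ^+ 2 / 2 / 2 by field.
lra.
Qed.

(** 0 <= ln v <= v - 1 for v >= 1, applied to v = u or v = 1/u; the sum of both squares avoids a
    case distinction under the integral. *)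
Lemma ln_sqr_le u : 0 < u -> ln u ^+ 2 <= (u - 1) ^+ 2 + (u^-1 - 1) ^+ 2.
Proof.
move=> u0.
have lnle (v : R) : 0 < v -> ln v <= v - 1.
  move=> v0; have := @le_ln1Dx R (v - 1).
  rewrite (_ : 1 + (v - 1) = v); last by ring.
  by apply; lra.
have [u1|u1] := leP 1 u.
  apply: (@le_trans _ _ ((u - 1) ^+ 2)); last by rewrite lerDl sqr_ge0.
  by rewrite lerXn2r ?nnegrE ?ln_ge0 ?subr_ge0// lnle.
apply: (@le_trans _ _ ((u^-1 - 1) ^+ 2)); last by rewrite lerDr sqr_ge0.
have iu : 1 <= u^-1 by rewrite invf_ge1// ltW.
rewrite -sqrrN -lnV ?posrE// lerXn2r ?nnegrE ?ln_ge0 ?subr_ge0//.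
by rewrite lnle// invr_gt0.
Qed.

End elementary_bounds.

Section gamma_neq0.
Context {R : realType}.
Implicit Types (z : R[i]) (x a s y A : R).

Lemma Gammar_S x : 0 < x -> Gammar (x + 1) = x * Gammar x.
Proof.
move=> x0; have x1 : 0 < x + 1 by rewrite addr_gt0.
have := @Gammac_S R x%:C x0; rewrite (_ : x%:C + 1 = (x + 1)%:C); last by rewrite rmorphD.
by rewrite (Gammac_real x0) (Gammac_real x1) -rmorphM => /complexI.
Qed.

(** The left-hand side is t^(A-1) exp(-t) (1 - y^2/2 ((t/A - 1)^2 + (A/t - 1)^2)), expanded so that
    each term integrates to a Gamma value. *)
Let lower_integrand A y (t : R) : 0 < t -> 0 < A ->
  t `^ (A - 1) * exp_kernel t - y ^+ 2 / 2 *
  ((t `^ (A + 1) * exp_kernel t) / A ^+ 2 - (t `^ A * exp_kernel t) / A * 2 +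
   t `^ (A - 1) * exp_kernel t + (A ^+ 2 * (t `^ (A - 3) * exp_kernel t) -
   2 * A * (t `^ (A - 2) * exp_kernel t) + t `^ (A - 1) * exp_kernel t)) <=
  t `^ (A - 1) * exp_kernel t * cos (y * (ln t - ln A)).
Proof.
move=> t0 A0.
have tA0 : 0 < t / A by rewrite divr_gt0.
have t1 (c d : R) : d = c + 1 -> t `^ d = t `^ c * t.
  by move=> ->; rewrite (powRDp _ _ t0) powRr1// ltW.
rewrite (t1 A (A + 1) erefl) (t1 (A - 1) A); last by ring.
rewrite (t1 (A - 2) (A - 1)); last by ring.
rewrite (t1 (A - 3) (A - 2)); last by ring.
set p := t `^ (A - 3) * exp_kernel t.
have p0 : 0 <= p by rewrite mulr_ge0 ?powR_ge0 ?exp_kernel_ge0.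
have h := cos_ge_quadratic (y * (ln t - ln A)).
have h2 := ln_sqr_le tA0.
rewrite (ln_div t0 A0) in h2.
have pt0 : 0 <= p * t ^+ 2 by rewrite mulr_ge0// sqr_ge0.
have -> : t `^ (A - 3) * t * t * exp_kernel t * cos (y * (ln t - ln A)) =
  p * t ^+ 2 * cos (y * (ln t - ln A)) by rewrite /p; ring.
apply: (le_trans _ (ler_wpM2l pt0 h)).
apply: (@le_trans _ _ (p * t ^+ 2 *
  (1 - y ^+ 2 / 2 * ((t / A - 1) ^+ 2 + ((t / A)^-1 - 1) ^+ 2)))).
  rewrite le_eqVlt; apply/orP; left; apply/eqP; rewrite /p; field.
  by apply/andP; split; exact: lt0r_neq0.
apply: ler_wpM2l => //; rewrite lerD2l lerN2 exprMn mulrAC.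
by apply: ler_wpM2l => //; rewrite divr_ge0// sqr_ge0.
Qed.

(* |Gamma (A + i y)| is at least the integral of t^(A-1) exp(-t) cos(y ln (t/A)),
   and this measure concentrates at t = A: use cos v >= 1 - v^2/2, then
   (ln u)^2 <= (u - 1)^2 + (1/u - 1)^2, whose integral at u = t/A is an explicit
   combination of Gamma values. *)
Lemma Gammac_neq0_large A y : 4 + 3 * y ^+ 2 <= A -> Gammac (A +i* y) != 0.
Proof.
move=> hA; have y2 : 0 <= y ^+ 2 := sqr_ge0 y.
have A0 : 0 < A by lra.
have a1 : 0 < A + 1 by lra.
have a2 : 0 < A + 1 + 1 by lra.
have a3 : 0 < A - 2 + 1 by lra.
have a4 : 0 < A - 2 by lra.
have a5 : 0 < A - 1 by lra.
have h1 : (A - 1) * (A - 2) / A <= A.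
  rewrite ler_pdivrMr//; have -> : (A - 1) * (A - 2) = A * A - (3 * A - 2) by ring.
  lra.
(* This is the integral of the minorant [L] below divided by Gamma(A - 2). The hypothesis bounds
   y^2/2 by (A - 4)/6, and [h1] bounds the quotient by A. *)
have h2 : 0 < (A - 1) * (A - 2) - y ^+ 2 / 2 * ((A - 1) * (A - 2) / A + A + 2).
  have h3 : y ^+ 2 / 2 * ((A - 1) * (A - 2) / A + A + 2) <= (A - 4) / 3 / 2 * (A + A + 2).
    apply: ler_pM; [lra| |lra|lra].
    have : 0 <= (A - 1) * (A - 2) / A by rewrite divr_ge0 ?mulr_ge0//; lra.
    lra.
  have h4 : (A - 4) / 3 / 2 * (A + A + 2) = (A - 4) * (A + 1) / 3 by field.
  have h5 : (A - 1) * (A - 2) - (A - 4) * (A + 1) / 3 = (A * (2 * A - 6) + 10) / 3 by field.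
  have h6 : 0 <= A * (2 * A - 6) by rewrite mulr_ge0; lra.
  rewrite h4 in h3; lra.
have z0 : 0 < complex.Re (A +i* y) by [].
apply/eqP; rewrite (GammacE z0) /rmellin => -[eR eI].
have me := @measurable_exp_kernel R.
have IR := mellin_integrable_Re me (mellin_integrable_exp_kernel z0).
have II := mellin_integrable_Im me (mellin_integrable_exp_kernel z0).
have pw (B s : R) : B = s + 1 -> 0 < B ->
    integ (fun t => t `^ s * exp_kernel t) /\ rint (fun t =>
      t `^ s * exp_kernel t) = Gammar B.
  move=> -> B0; split; last by rewrite (GammarE B0) addrK.
  by have := mellin_integrable_exp_kernel B0; rewrite /mellin_integrable addrK.
have [i0 e0] := pw A (A - 1) ltac:(ring) A0.
have [i1 e1] := pw (A + 1) A erefl a1.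
have [i2 e2] := pw (A + 1 + 1) (A + 1) erefl a2.
have [i3 e3] := pw (A - 2 + 1) (A - 2) erefl a3.
have [i4 e4] := pw (A - 2) (A - 3) ltac:(ring) a4.
have g0 : 0 < Gammar (A - 2) by exact: Gammar_gt0.
have E3 : Gammar (A - 2 + 1) = (A - 2) * Gammar (A - 2) by exact: Gammar_S.
have E0 : Gammar A = (A - 1) * (A - 2) * Gammar (A - 2).
  rewrite -mulrA -E3 (_ : A - 2 + 1 = A - 1); last by ring.
  rewrite -(Gammar_S a5) subrK; exact: erefl.
have E1 : Gammar (A + 1) = A * Gammar A by exact: Gammar_S.
have E2 : Gammar (A + 1 + 1) = (A + 1) * (A * Gammar A) by rewrite -E1; exact: Gammar_S.
pose L t := t `^ (A - 1) * exp_kernel t - y ^+ 2 / 2 *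
  ((t `^ (A + 1) * exp_kernel t) / A ^+ 2 - (t `^ A * exp_kernel t) / A * 2 +
   t `^ (A - 1) * exp_kernel t + (A ^+ 2 * (t `^ (A - 3) * exp_kernel t) -
   2 * A * (t `^ (A - 2) * exp_kernel t) + t `^ (A - 1) * exp_kernel t)).
pose k0 := 1 - y ^+ 2. pose k2 := - (y ^+ 2 / 2) / A ^+ 2. pose k1 := y ^+ 2 / A.
pose k4 := - (y ^+ 2 / 2) * A ^+ 2. pose k3 := y ^+ 2 * A.
have A_neq0 : A != 0 by rewrite gt_eqF.
have LE t : L t = k0 * (t `^ (A - 1) * exp_kernel t) + (k2 * (t `^ (A + 1) * exp_kernel t) +
  (k1 * (t `^ A * exp_kernel t) + (k4 * (t `^ (A - 3) * exp_kernel t) + k3 * (t `^ (A -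
    2) * exp_kernel t)))).
  by rewrite /L /k0 /k1 /k2 /k3 /k4; field.
have j3 := integD (integZ k4 i4) (integZ k3 i3).
have j2 := integD (integZ k1 i1) j3.
have j1 := integD (integZ k2 i2) j2.
have j0 := integD (integZ k0 i0) j1.
have iL : integ L by rewrite (funext LE).
have rL : rint L = Gammar (A - 2) *
    ((A - 1) * (A - 2) - y ^+ 2 / 2 * ((A - 1) * (A - 2) / A + A + 2)).
  rewrite (funext LE) (rintD (integZ k0 i0) j1) (rintD (integZ k2 i2) j2).
  rewrite (rintD (integZ k1 i1) j3) (rintD (integZ k4 i4) (integZ k3 i3)).
  rewrite (rintZ _ i0) (rintZ _ i1) (rintZ _ i2) (rintZ _ i3) (rintZ _ i4).
  rewrite e0 e1 e2 e3 e4 E2 E1 E3 E0 /k0 /k1 /k2 /k3 /k4.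
  by field.
(* The real part of A^(-iy) t^(A-1+iy) exp(-t), which integrates to 0 if Gamma(A + iy) = 0. *)
have cpw t : t `^ (A - 1) * exp_kernel t * cos (y * (ln t - ln A)) =
    cos (y * ln A) * (complex.Re (cpow t (A +i* y - 1)) * exp_kernel t) +
    sin (y * ln A) * (complex.Im (cpow t (A +i* y - 1)) * exp_kernel t).
  by rewrite Re_cpow Im_cpow /= subr0 mulrBr cosB; ring.
have iC : integ (fun t => t `^ (A - 1) * exp_kernel t * cos (y * (ln t - ln A))).
  by rewrite (funext cpw); apply: integD; exact: integZ.
have rC : rint (fun t => t `^ (A - 1) * exp_kernel t * cos (y * (ln t - ln A))) = 0.
  rewrite (funext cpw) (rintD (integZ _ IR) (integZ _ II)) (rintZ _ IR) (rintZ _ II).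
  by rewrite eR eI !mulr0 addr0.
have le t : L t <= t `^ (A - 1) * exp_kernel t * cos (y * (ln t - ln A)).
  have [t0|t0] := leP t 0; last exact: lower_integrand.
  by rewrite /L (exp_kernel_vanish t0) !(mulr0, mul0r, subr0, addr0).
have := rint_le iL iC le; rewrite rC rL.
by rewrite leNgt (mulr_gt0 g0 h2).
Qed.

(** Adding an integer k keeps the imaginary part, so z + k reaches the region of
    [Gammac_neq0_large]; Gamma(z) is a factor of Gamma(z + k). *)
Lemma Gammac_neq0 z : 0 < complex.Re z -> Gammac z != 0.
Proof.
case: z => a y /= a0.
pose k := (Num.truncn (4 + 3 * y ^+ 2)).+1.
have hk : 4 + 3 * y ^+ 2 <= a + k%:R.
  apply: (@le_trans _ _ k%:R); last by rewrite lerDr ltW.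
  by rewrite ltW// truncnS_gt.
have := Gammac_neq0_large hk.
have -> : (a + k%:R) +i* y = (a +i* y) + k%:R.
  rewrite -(rmorph_nat (real_complex R)).
  by apply/eqP; rewrite eq_complex /= addr0 !eqxx.
rewrite Gammac_poch//; apply: contraNneq => ->.
by rewrite mulr0.
Qed.

End gamma_neq0.

(** * Uniqueness of Mellin transforms *)

Section poisson.
Context {R : realType}.
Implicit Types x t d v : R.

Lemma integ_exp_kernel : integ (@exp_kernel R).
Proof.
have := @mellin_integrable_exp_kernel R 1 ltr01; rewrite /mellin_integrable; congr integ.
by apply/funext => x; rewrite subrr powRr0 mul1r.
Qed.

Lemma integ_exp_kernelM d : 0 < d -> integ (fun t => exp_kernel (d * t)).
Proof.
move=> d0; have := integrable_affine 0 d0 integ_exp_kernel.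
by congr integ; apply/funext => x; rewrite addr0.
Qed.

Lemma measurable_cosM v : measurable_fun setT (fun t => cos (v * t)).
Proof.
apply: (@measurableT_comp _ _ _ _ _ _ (@cos R)).
  by apply: continuous_measurable_fun; exact: continuous_cos.
exact: measurable_funM.
Qed.

Lemma exp_kernelM d t : 0 < d -> 0 < t -> exp_kernel (d * t) = expR (- (d * t)).
Proof. by move=> d0 t0; rewrite exp_kernelE// mulr_gt0. Qed.

Lemma exp_kernelM0 d t : 0 < d -> t <= 0 -> exp_kernel (d * t) = 0.
Proof. by move=> d0 t0; rewrite exp_kernel_vanish// pmulr_rle0. Qed.

Lemma integ_exp_kernel_cos d v : 0 < d -> integ (fun t => exp_kernel (d * t) * cos (v * t)).
Proof.
move=> d0; have i1 := integ_exp_kernelM d0.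
apply: (integ_le _ _ i1).
  by apply: measurable_funM; [exact: integ_measurable i1|exact: measurable_cosM].
move=> t; rewrite normrM (ger0_norm (exp_kernel_ge0 _)).
by apply: ler_piMr; [exact: exp_kernel_ge0|exact: cos_max].
Qed.

(** The Poisson kernel as a cosine transform, which is how the integrals against exponentials reach
    it. *)
Lemma poisson_integral d v : 0 < d ->
  rint (fun t => exp_kernel (d * t) * cos (v * t)) = d / (d ^+ 2 + v ^+ 2).
Proof.
move=> d0.
have D0 : 0 < d ^+ 2 + v ^+ 2 by rewrite ltr_wpDr ?sqr_ge0// exprn_gt0.
(* The real part of exp((-d + iv) t)/(-d + iv). *)
pose F t := expR (- d * t) * ((v * sin (v * t) - d * cos (v * t)) / (d ^+ 2 + v ^+ 2)).
have did t c : is_derive t 1 (fun u : R => c * u) c.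
  by apply: is_derive_eq (real_deriveZ c (is_derive_id t 1)) _; rewrite mulr1.
have dF0 t : is_derive t 1 F (expR (- d * t) * cos (v * t)).
  have d1 := @real_derive_comp R expR (fun u =>
    - d * u) t _ _ (is_derive_expR (- d * t)) (did t (- d)).
  have d2 := @real_derive_comp R sin (fun u =>
    v * u) t _ _ (is_derive_sin (v * t)) (did t v).
  have d3 := @real_derive_comp R cos (fun u =>
    v * u) t _ _ (is_derive_cos (v * t)) (did t v).
  have d4 := real_deriveM (real_deriveD (real_deriveZ v d2) (real_deriveZ (- d) d3))
    (real_derive_cst (d ^+ 2 + v ^+ 2)^-1 t).
  have d5 := real_deriveM d1 d4.
  have -> : F = (fun u => expR (- d * u) * ((v * sin (v * u) + - d * cos (v * u)) * (d ^+
    2 + v ^+ 2)^-1)).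
    by apply/funext => u; rewrite /F; ring.
  apply: is_derive_eq d5 _; field; exact: lt0r_neq0.
have dF t : 0 < t -> is_derive t 1 F (exp_kernel (d * t) * cos (v * t)).
  by move=> t0; apply: is_derive_eq (dF0 t) _; rewrite (exp_kernelM d0 t0) mulNr.
have cf t : 0 < t -> {for t, continuous (fun t => exp_kernel (d * t) * cos (v * t))}.
  move=> t0.
  have e1 := is_derive_exp_kernel (mulr_gt0 d0 t0).
  have d1 := @real_derive_comp R (@exp_kernel R) (fun u => d * u) t _ _ e1 (did t d).
  have d3 := @real_derive_comp R cos (fun u =>
    v * u) t _ _ (is_derive_cos (v * t)) (did t v).
  exact: is_derive_continuous (real_deriveM d1 d3).
have F0 : F t @[t --> 0^'+] --> - (d / (d ^+ 2 + v ^+ 2)).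
  have -> : - (d / (d ^+ 2 + v ^+ 2)) = F 0.
    by rewrite /F !mulr0 sin0 cos0 expR0 mulr0 mulr1 mul1r sub0r mulNr.
  apply: cvg_at_right_filter; exact: is_derive_continuous (dF0 0).
pose C := (`|v| + d) / (d ^+ 2 + v ^+ 2).
have C0 : 0 <= C.
  by apply: divr_ge0; [apply: addr_ge0; [exact: normr_ge0|exact: ltW]|exact: ltW].
have Foo : F t @[t --> +oo] --> 0.
  apply: norm_cvg0; apply: (@squeeze_cvgr _ _ _ _ (cst 0) (fun t => (C / d) * t^-1)).
  - near=> t; apply/andP; split; first exact: normr_ge0.
    have t0 : 0 < t by near: t; exact: nbhs_pinfty_gt.
    have e1 : expR (- d * t) <= d^-1 * t^-1.
      rewrite mulNr expRN -invfM lef_pV2 ?posrE ?mulr_gt0 ?expR_gt0//.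
      by apply: le_trans (expR_ge1Dx _); rewrite mulrC lerDr.
    have e2 : `|(v * sin (v * t) - d * cos (v * t)) / (d ^+ 2 + v ^+ 2)| <= C.
      rewrite normrM (gtr0_norm (x := (d ^+ 2 + v ^+ 2)^-1)) ?invr_gt0//.
      apply: ler_wpM2r; first by rewrite invr_ge0 ltW.
      apply: le_trans (ler_normB _ _) _; rewrite !normrM; apply: lerD.
        by apply: ler_piMr; [exact: normr_ge0|exact: sin_max].
      by rewrite (gtr0_norm d0); apply: ler_piMr; [exact: ltW|exact: cos_max].
    rewrite /F normrM (ger0_norm (expR_ge0 _)).
    have -> : C / d * t^-1 = (d^-1 * t^-1) * C by ring.
    by apply: ler_pM => //; exact: expR_ge0.
  - exact: cvg_cst.
  - rewrite -(mulr0 (C / d)); apply: cvgMr; exact: cvg_invr_pinfty.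
have v0 : vanish (fun t => exp_kernel (d * t) * cos (v * t)).
  by move=> t t0; rewrite (exp_kernelM0 d0 t0) mul0r.
by rewrite (FTC_pos (integ_exp_kernel_cos v d0) v0 dF cf F0 Foo) sub0r opprK.
Unshelve. all: by end_near. Qed.

End poisson.

Section mellin_uniqueness.
Context {R : realType}.
Variable psi : R -> R.
Hypotheses (ipsi : integ psi) (psi0 : vanish psi).

Let mlncos (t u0 : R) : measurable_fun setT (fun x : R => cos (t * (ln x - u0))).
Proof.
apply: (measurableT_comp (measurable_cosM t)).
by apply: measurable_funB => //; exact: measurable_ln.
Qed.

(** Replace the kernel by its cosine integral, exchange, and expand cos(t ln x - t u0): for each t
    the inner integral is a combination of the two vanishing ones. *)
Let poisson_zero (d u0 : R) : 0 < d ->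
  (forall t, rint (fun x => psi x * cos (t * ln x)) = 0) ->
  (forall t, rint (fun x => psi x * sin (t * ln x)) = 0) ->
  integ (fun x => psi x * (d / (d ^+ 2 + (ln x - u0) ^+ 2))) /\
  rint (fun x => psi x * (d / (d ^+ 2 + (ln x - u0) ^+ 2))) = 0.
Proof.
move=> d0 hc hs.
have mpsi := integ_measurable ipsi.
have ie := integ_exp_kernelM d0.
have me := integ_measurable ie.
pose h x t := psi x * (exp_kernel (d * t) * cos ((ln x - u0) * t)).
have mcos : measurable_fun setT (@cos R).
  by apply: continuous_measurable_fun; exact: continuous_cos.
have mh : measurable_fun setT (fun p : R * R => h p.1 p.2).
  apply: measurable_funM; first exact: (measurableT_comp mpsi).
  apply: measurable_funM; first exact: (measurableT_comp me).
  apply: (measurableT_comp mcos); apply: measurable_funM => //.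
  by apply: measurable_funB => //; exact: (measurableT_comp (@measurable_ln R)).
have hle x t : `|h x t| <= exp_kernel (d * t) * `|psi x|.
  rewrite /h mulrA (mulrC (psi x)) !normrM (ger0_norm (exp_kernel_ge0 _)).
  by apply: ler_piMr; [rewrite mulr_ge0// exp_kernel_ge0|exact: cos_max].
have ih t : integ (h ^~ t).
  apply: (integ_le _ (hle ^~ t) (integZ _ (integ_norm ipsi))).
  apply: measurable_funM => //; apply: measurable_funM => //.
  under eq_fun do rewrite mulrC; exact: mlncos.
have iG : integ (fun t => rint (fun x => `|psi x|) * exp_kernel (d * t)) by exact: integZ.
have hG t : rint (fun x => `|h x t|) <= rint (fun x => `|psi x|) * exp_kernel (d * t).
  rewrite mulrC -(rintZ _ (integ_norm ipsi)).
  exact: (rint_le (integ_norm (ih t)) (integZ _ (integ_norm ipsi)) (hle ^~ t)).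
have [i1 e1 _] := fubini_real mh ih iG hG.
have inE x : rint (h x) = psi x * (d / (d ^+ 2 + (ln x - u0) ^+ 2)).
  by rewrite /h (rintZ _ (integ_exp_kernel_cos (ln x - u0) d0)) (poisson_integral _ d0).
rewrite (funext inE) in i1 e1; split; first exact: i1.
rewrite e1 (_ : (fun y => _) = cst 0); first by rewrite (Rintegral_cst _ measurableT) mul0r.
have mln : measurable_fun setT (@ln R) by exact: measurable_ln.
apply/funext => t.
have ic : integ (fun x => psi x * cos (t * ln x)).
  apply: (integ_le _ _ (integ_norm ipsi)).
    by apply: measurable_funM => //; apply: (measurableT_comp mcos); exact: measurable_funM.
  by move=> x; rewrite normrM; apply: ler_piMr; [exact: normr_ge0|exact: cos_max].
have is' : integ (fun x => psi x * sin (t * ln x)).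
  apply: (integ_le _ _ (integ_norm ipsi)).
    apply: measurable_funM => //; apply: (@measurableT_comp _ _ _ _ _ _ (@sin R)).
      by apply: continuous_measurable_fun; exact: continuous_sin.
    exact: measurable_funM.
  by move=> x; rewrite normrM; apply: ler_piMr; [exact: normr_ge0|exact: sin_max].
transitivity (rint (fun x => exp_kernel (d * t) * cos (t * u0) * (psi x * cos (t * ln x)) +
    exp_kernel (d * t) * sin (t * u0) * (psi x * sin (t * ln x)))).
  apply: eq_Rintegral => x _; rewrite /h.
  have -> : (ln x - u0) * t = t * ln x - t * u0 by ring.
  by rewrite cosB; ring.
by rewrite (rintD (integZ _ ic) (integZ _ is')) (rintZ _ ic) (rintZ _ is') hc hs !mulr0
  addr0.
Qed.

(* If psi > m on a neighbourhood of x0, pair psi with the Poisson kernel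
   d / (d^2 + (ln x - ln x0)^2): the part of [x0, x0 exp d] contributes at least
   m x0 / 2, whereas the points at logarithmic distance at least e contribute
   at least - (d / e^2) int |psi|. *)
Lemma no_positive_value (x0 : R) : 0 < x0 -> {for x0, continuous psi} ->
  (forall t, rint (fun x => psi x * cos (t * ln x)) = 0) ->
  (forall t, rint (fun x => psi x * sin (t * ln x)) = 0) ->
  ~ 0 < psi x0.
Proof.
move=> x00 cpsi hc hs psix0.
pose u0 := ln x0; pose m := psi x0 / 2.
have m0 : 0 < m by rewrite divr_gt0.
(* The neighbourhood is taken in the variable u = ln x, in which the Poisson kernel is a
   translate. *)
have [e e0 He] : exists2 e, 0 < e & forall u, `|u - u0| < e -> m < psi (expR u).
  have eu0 : expR u0 = x0 by rewrite /u0 lnK.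
  have c1 : {for u0, continuous (fun u => psi (expR u))}.
    apply: continuous_comp; first exact: continuous_expR.
    by rewrite eu0.
  have c2 : psi (expR u) @[u --> u0] --> psi (expR u0) by exact: c1.
  have /cvgrPdist_lt/(_ _ m0)[e /= e0 He] := c2.
  exists e => // u ue; have := He u; rewrite /= distrC eu0 => /(_ ue).
  by rewrite ltr_norml /m => /andP[_]; lra.
pose N := rint (fun x => `|psi x|).
have N0 : 0 <= N by apply: Rintegral_ge0.
(* The first bound keeps [x0, x0 exp d] inside the neighbourhood, the second makes the distant
   contribution d N/e^2 smaller than m x0/2; N + 1 keeps the denominator positive when N = 0. *)
pose d := Num.min (e / 2) (m * x0 * e ^+ 2 / (4 * (N + 1))).
have N1 : 0 < 4 * (N + 1) by rewrite mulr_gt0// ltr_wpDl.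
have d0 : 0 < d by rewrite lt_min !divr_gt0// mulr_gt0 ?exprn_gt0// mulr_gt0.
have de : d < e by rewrite /d gt_min; apply/orP; left; lra.
have dN : d * N / e ^+ 2 < m * x0 / 2.
  have h : d <= m * x0 * e ^+ 2 / (4 * (N + 1)) by rewrite /d ge_min lexx orbT.
  have e20 : 0 < e ^+ 2 by rewrite exprn_gt0.
  have mx : 0 < m * x0 by rewrite mulr_gt0.
  rewrite ltr_pdivrMr//.
  apply: (@le_lt_trans _ _ (m * x0 * e ^+ 2 / (4 * (N + 1)) * N)); first exact: ler_wpM2r.
  have M0 : 0 < m * x0 * e ^+ 2 by rewrite mulr_gt0.
  have -> : m * x0 * e ^+ 2 / (4 * (N + 1)) * N = (m * x0 * e ^+ 2) * (N / (4 * (N + 1)))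
    by ring.
  have -> : m * x0 / 2 * e ^+ 2 = (m * x0 * e ^+ 2) * 2^-1 by ring.
  rewrite ltr_pM2l// ltr_pdivrMr//; lra.
have [iP eP] := poisson_zero u0 d0 hc hs.
pose b := x0 * expR d.
have x0b : x0 <= b by rewrite /b ler_peMr ?ltW// -expR0 ltr_expR.
have iI := @integrable_indic_itv R x0 b true false.
have iL : integ (fun x => m / (2 * d) * \1_(`[x0,
  b]%classic : set R) x - d / e ^+ 2 * `|psi x|).
  by apply: integD; [exact: integZ iI|apply: integN; exact: integZ (integ_norm ipsi)].
have le_pt x : m / (2 * d) * \1_(`[x0, b]%classic : set R) x - d / e ^+ 2 * `|psi x| <=
    psi x * (d / (d ^+ 2 + (ln x - u0) ^+ 2)).
  have t1 : 0 <= d / e ^+ 2 * `|psi x| by rewrite mulr_ge0// divr_ge0 ?sqr_ge0// ltW.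
  have dv : 0 < d ^+ 2 + (ln x - u0) ^+ 2 by rewrite ltr_wpDr ?sqr_ge0// exprn_gt0.
  have P0 : 0 <= d / (d ^+ 2 + (ln x - u0) ^+ 2) by rewrite divr_ge0// ltW.
  rewrite indicE; have [xI|xI] := boolP (x \in _).
    move: xI; rewrite inE/= in_itv/= => /andP[xa xb].
    have xp : 0 < x by exact: lt_le_trans xa.
    have l0 : 0 <= ln x - u0 by rewrite subr_ge0 ler_ln.
    have l1 : ln x - u0 <= d.
      by rewrite lerBlDl /u0 -(expRK d) -lnM ?posrE ?expR_gt0// ler_ln ?posrE// mulr_gt0
        ?expR_gt0.
    have mp : m <= psi x.
      have := He (ln x); rewrite lnK ?posrE// => h; apply/ltW/h.
      by rewrite (ger0_norm l0) (le_lt_trans l1).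
    rewrite mulr1 lerBlDr; apply: ler_wpDr => //.
    (* 1/(2d) is the value of the kernel at logarithmic distance d, its minimum on [x0, b]. *)
    have -> : m / (2 * d) = m * (d / (d ^+ 2 + d ^+ 2)).
      have -> : d ^+ 2 + d ^+ 2 = d * (2 * d) by ring.
      by rewrite [(d * (2 * d))^-1]invfM mulVKf// gt_eqF.
    apply: ler_pM; [exact: ltW|by rewrite divr_ge0 ?addr_ge0 ?sqr_ge0// ltW|exact: mp|].
    apply: ler_wpM2l; first exact: ltW.
    rewrite lef_pV2 ?posrE//; last by rewrite addr_gt0 ?exprn_gt0.
    by rewrite lerD2l lerXn2r ?nnegrE// ltW.
  rewrite mulr0 sub0r.
  have [xp|xp] := leP x 0; first by rewrite (psi0 xp) normr0 mulr0 oppr0 mul0r.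
  (* Inside the neighbourhood but off [x0, b], psi is still positive and can be discarded. *)
  have [lu|lu] := ltP `|ln x - u0| e.
    have := He _ lu; rewrite lnK ?posrE// => h.
    apply: (@le_trans _ _ 0); first by rewrite oppr_le0.
    by rewrite mulr_ge0// ltW// (lt_trans m0).
  apply: (@le_trans _ _ (- (`|psi x| * (d / (d ^+ 2 + (ln x - u0) ^+ 2))))).
    rewrite lerN2 mulrC; apply: ler_wpM2r; first exact: normr_ge0.
    apply: ler_wpM2l; first exact: ltW.
    rewrite lef_pV2 ?posrE ?exprn_gt0//.
    rewrite -[X in _ + X]real_normK ?num_real//.
    by apply: ler_wpDl; [exact: sqr_ge0|rewrite lerXn2r ?nnegrE// ltW].
  rewrite -mulNr; apply: ler_wpM2r => //.
  by have := ler_norm (- psi x); rewrite normrN => h; lra.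
have := rint_le iL iP le_pt.
rewrite eP (rintB (integZ _ iI) (integZ _ (integ_norm ipsi))).
rewrite (rintZ _ iI) (rintZ _ (integ_norm ipsi)) (rint_indic_itv x0b) -/N.
(* From exp d >= 1 + d; the length of [x0, b] thus compensates the d in m/(2d). *)
have ed : x0 * d <= b - x0.
  have := expR_ge1Dx d; rewrite /b => h.
  have -> : x0 * expR d - x0 = x0 * (expR d - 1) by ring.
  by apply: ler_wpM2l; [exact: ltW|lra].
have h1 : m * x0 / 2 <= m / (2 * d) * (b - x0).
  have -> : m * x0 / 2 = m / (2 * d) * (x0 * d) by field; rewrite gt_eqF.
  by apply: ler_wpM2l => //; rewrite divr_ge0 ?mulr_ge0// ltW.
have -> : d / e ^+ 2 * N = d * N / e ^+ 2 by ring.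
move: dN h1; lra.
Qed.

End mellin_uniqueness.

Lemma mellin_unique (R : realType) (psi : R -> R) : integ psi -> vanish psi ->
  (forall x : R, 0 < x -> {for x, continuous psi}) ->
  (forall t, rint (fun x => psi x * cos (t * ln x)) = 0) ->
  (forall t, rint (fun x => psi x * sin (t * ln x)) = 0) ->
  forall x : R, 0 < x -> psi x = 0.
Proof.
move=> ipsi psi0 cpsi hc hs x x0.
case: (ltgtP (psi x) 0) => // [neg|pos]; last first.
  by case: (no_positive_value ipsi psi0 x0 (cpsi x x0) hc hs).
have ic t : integ (fun x => psi x * cos (t * ln x)).
  apply: (integ_le _ _ (integ_norm ipsi)).
    apply: measurable_funM; first exact: integ_measurable.
    by apply: (@measurableT_comp _ _ _ _ _ _ (fun u => cos (t * u)));
      [exact: measurable_cosM|exact: measurable_ln].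
  by move=> u; rewrite normrM; apply: ler_piMr; [exact: normr_ge0|exact: cos_max].
have is' t : integ (fun x => psi x * sin (t * ln x)).
  apply: (integ_le _ _ (integ_norm ipsi)).
    apply: measurable_funM; first exact: integ_measurable.
    apply: (@measurableT_comp _ _ _ _ _ _ (@sin R)).
      by apply: continuous_measurable_fun; exact: continuous_sin.
    by apply: measurable_funM => //; exact: measurable_ln.
  by move=> u; rewrite normrM; apply: ler_piMr; [exact: normr_ge0|exact: sin_max].
have n0 : vanish (fun x => - psi x) by move=> u u0; rewrite psi0// oppr0.
have cn : {for x, continuous (fun x => - psi x)} by apply: continuousN; exact: cpsi.
have hc' t : rint (fun x => - psi x * cos (t * ln x)) = 0.
  under eq_Rintegral do rewrite mulNr -mulN1r.
  by rewrite (rintZ _ (ic t)) hc mulr0.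
have hs' t : rint (fun x => - psi x * sin (t * ln x)) = 0.
  under eq_Rintegral do rewrite mulNr -mulN1r.
  by rewrite (rintZ _ (is' t)) hs mulr0.
by case: (no_positive_value (integN ipsi) n0 x0 cn hc' hs'); rewrite oppr_gt0.
Qed.

(** * Multiple convolutions and their derivatives *)

Definition is_kernel (R : realType) (f : R -> R) : Prop :=
  [/\ vanish f, measurable_fun setT f, forall x, 0 <= f x &
      forall s, 1 < s -> mellin_integrable s f].

(* g j stands for w_0 with its last Gamma parameter c raised by j.  The threshold
   1, here and in [is_kernel], is available because all the exponents exceed -1. *)
Record ladder (R : realType) (c : R) (g : nat -> R -> R) : Prop := Ladder {
  ladder_vanish : forall j, vanish (g j);
  ladder_ge0 : forall j x, 0 <= g j x;
  ladder_derive : forall j (x : R), 0 < x ->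
    is_derive x 1 (g j) (((c + j%:R) * g j x - g j.+1 x) / x);
  ladder_decays : forall j, decays 1 (g j) }.

Section kernels.
Context {R : realType}.
Implicit Types (z : R[i]) (x a b c s : R).

Lemma gamma_kernelE a : gamma_kernel a = (fun x => x `^ a * exp_kernel x).
Proof.
apply/funext => x; rewrite /gamma_kernel; have [x0|x0] := ltP 0 x.
  by rewrite exp_kernelE.
by rewrite (exp_kernel_vanish x0) mulr0.
Qed.

Lemma beta_kernelE a b :
  beta_kernel a b = (fun x => (Gammar (b - a))^-1 * (x `^ a * beta_factor (b - a) x)).
Proof.
apply/funext => x; rewrite /beta_kernel /beta_factor; case: ifP => _; first by ring.
by rewrite !mulr0.
Qed.

Lemma mellin_integrable_shift a s (f : R -> R) : vanish f -> mellin_integrable (s + a) f ->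
  mellin_integrable s (fun x => x `^ a * f x).
Proof.
move=> f0; rewrite /mellin_integrable; congr integ; apply/funext => x.
have [x0|x0] := leP x 0; first by rewrite (f0 _ x0) !mulr0.
by rewrite mulrA -(powRDp _ _ x0); congr (powR _ _ * _); ring.
Qed.

Lemma rmellin_shift a z (f : R -> R) : vanish f ->
  rmellin (fun x => x `^ a * f x) z = rmellin f (z + a%:C).
Proof.
move=> f0.
have e x : 0 < x -> cpow x (z + a%:C - 1) = cpow x (z - 1) * (x `^ a)%:C.
  by move=> x0; rewrite -cpow_real -(cpowD _ _ x0) addrAC.
rewrite /rmellin; congr (_ +i* _); apply: eq_Rintegral => x _.
- have [x0|x0] := leP x 0; first by rewrite (f0 _ x0) !mulr0.
  by rewrite (e x x0); case: (cpow _ _) => u v /=; ring.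
- have [x0|x0] := leP x 0; first by rewrite (f0 _ x0) !mulr0.
  by rewrite (e x x0); case: (cpow _ _) => u v /=; ring.
Qed.

Lemma gamma_is_kernel a : -1 < a -> is_kernel (gamma_kernel a).
Proof.
move=> a1; rewrite gamma_kernelE; split.
- by move=> x x0; rewrite (exp_kernel_vanish x0) mulr0.
- by apply: measurable_funM; [exact: measurable_powR|exact: measurable_exp_kernel].
- by move=> x; rewrite mulr_ge0 ?powR_ge0 ?exp_kernel_ge0.
- move=> s s1; apply: mellin_integrable_shift; first exact: exp_kernel_vanish.
  by apply: mellin_integrable_exp_kernel; lra.
Qed.

Lemma rmellin_gamma_kernel a z : 0 < complex.Re z + a ->
  rmellin (gamma_kernel a) z = Gammac (z + a%:C).
Proof.
move=> za; rewrite gamma_kernelE rmellin_shift; last exact: exp_kernel_vanish.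
by rewrite GammacE// raddfD.
Qed.

Lemma beta_is_kernel a b : -1 < a -> a < b -> is_kernel (beta_kernel a b).
Proof.
move=> a1 ab; rewrite beta_kernelE.
have q0 : 0 < b - a by rewrite subr_gt0.
split.
- by move=> x x0; rewrite (beta_factor_vanish _ x0) !mulr0.
- apply: measurable_funM => //; apply: measurable_funM; first exact: measurable_powR.
  exact: measurable_beta_factor.
- move=> x; rewrite mulr_ge0 ?invr_ge0 ?(ltW (Gammar_gt0 q0))//.
  by rewrite mulr_ge0 ?powR_ge0 ?beta_factor_ge0.
- move=> s s1.
  have h : mellin_integrable s (fun x => x `^ a * beta_factor (b - a) x).
    apply: mellin_integrable_shift; first exact: beta_factor_vanish.
    by apply: mellin_integrable_beta_factor => //; lra.
  have := integZ (Gammar (b - a))^-1 h.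
  by rewrite /mellin_integrable; congr integ; apply/funext => x; rewrite mulrCA.
Qed.

(** [beta_integral] at z + a with q = b - a, kept as a product: the division by Gamma is done once,
    in the final theorem. *)
Lemma rmellin_beta_kernel a b z : a < b -> 0 < complex.Re z + a ->
  rmellin (beta_kernel a b) z * Gammac (z + b%:C) = Gammac (z + a%:C).
Proof.
move=> ab za.
have q0 : 0 < b - a by rewrite subr_gt0.
have za' : 0 < complex.Re (z + a%:C) by rewrite raddfD.
have mb : mellin_integrable (complex.Re z) (fun x => x `^ a * beta_factor (b - a) x).
  by apply: mellin_integrable_shift; [exact: beta_factor_vanish|exact:
    mellin_integrable_beta_factor].
rewrite beta_kernelE rmellinZ//; last first.
  by apply: measurable_funM; [exact: measurable_powR|exact: measurable_beta_factor].
rewrite rmellin_shift; last exact: beta_factor_vanish.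
have := beta_integral q0 za' erefl.
have -> : z + a%:C + (b - a)%:C = z + b%:C.
  by rewrite -addrA; congr (_ + _); rewrite -rmorphD addrCA subrr addr0.
move=> e; rewrite -mulrA (mulrC (rmellin _ _)) -e mulrCA -rmorphM.
by rewrite mulVf ?mulr1// gt_eqF// Gammar_gt0.
Qed.

End kernels.

Section ladders.
Context {R : realType}.
Implicit Types (z : R[i]) (x c s : R) (f : R -> R) (g : nat -> R -> R).

Lemma ladder_continuous c g j x : ladder c g -> 0 < x -> {for x, continuous (g j)}.
Proof. by move=> lg x0; exact: is_derive_continuous (ladder_derive lg j x0). Qed.

Lemma ladder_measurable c g j : ladder c g -> measurable_fun setT (g j).
Proof.
move=> lg; apply: measurable_pos; first exact: (ladder_vanish lg).
by move=> x; exact: ladder_continuous lg.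
Qed.

Lemma ladder_mellin_integrable c g j s : ladder c g -> 1 < s -> mellin_integrable s (g j).
Proof.
move=> lg; apply: decays_mellin_integrable.
- exact: ladder_measurable lg.
- exact: (ladder_vanish lg).
- exact: (ladder_decays lg).
Qed.

Lemma ladder_gamma c : -1 < c -> ladder c (fun j => gamma_kernel (c + j%:R)).
Proof.
move=> c1.
have cj j : -1 < c + j%:R by rewrite (lt_le_trans c1)// lerDl.
split=> [j x|j x|j x x0|j s s1].
- by have [h _ _ _] := gamma_is_kernel (cj j); exact: h.
- by have [_ _ h _] := gamma_is_kernel (cj j); exact: h.
- rewrite !gamma_kernelE.
  apply: is_derive_eq (real_deriveM (is_derive1_powR (c + j%:R) x0) (is_derive_exp_kernel
    x0)) _.
  have -> : c + j.+1%:R = (c + j%:R - 1) + 1 + 1 by rewrite -natr1; ring.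
  rewrite [X in X * - _](_ : _ = x `^ (c + j%:R - 1 + 1)); last by congr powR; ring.
  rewrite [X in (_ + j%:R) * (X * _)](_ : _ = x `^ (c + j%:R - 1 + 1));
    last by congr powR; ring.
  rewrite !(powRDp _ _ x0) (powRr1 (ltW x0)); field.
  exact: lt0r_neq0.
(* s > 1 and c + j > -1 make the total power of x nonnegative, so that exp(-x) bounds it on the
   whole half-line. *)
- have h : 0 <= s + (c + j%:R) by have := cj j; lra.
  have [C HC] := powR_expR_bound h.
  exists C => x x0; rewrite gamma_kernelE ger0_norm ?mulr_ge0 ?powR_ge0 ?exp_kernel_ge0//.
  by rewrite mulrA -(powRDp _ _ x0) (exp_kernelE x0) HC.
Qed.

(** The decay of g at x/t separates x from t. This one estimate gives integrability in t, domination
    of the derivative in x, and decay of the convolution. *)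
Lemma conv_bound f (g : R -> R) s C x t : vanish f -> (forall x, 0 <= f x) ->
  (forall y, 0 < y -> y `^ s * `|g y| <= C) -> 0 < x ->
  `|f t * g (x / t) / t| <= C * x `^ (- s) * (t `^ (s - 1) * f t).
Proof.
move=> f0 fge0 HC x0; have [t0|t0] := leP t 0.
  by rewrite (f0 _ t0) !(mulr0, mul0r) normr0.
have xt : 0 < x / t by rewrite divr_gt0.
have h := HC _ xt.
have e : x `^ s = (x / t) `^ s * t `^ s.
  by rewrite -(powRM _ (ltW xt) (ltW t0)); congr powR; field; exact: lt0r_neq0.
have xs : 0 < x `^ s by exact: powR_gt0.
have ts : 0 < t `^ s by exact: powR_gt0.
have xts : 0 < (x / t) `^ s by exact: powR_gt0.
rewrite !normrM (ger0_norm (fge0 t)) normfV (gtr0_norm t0).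
have g1 : `|g (x / t)| <= C * x `^ (- s) * t `^ s.
  rewrite powRN e invfM.
  have -> : C * (((x / t) `^ s)^-1 / t `^ s) * t `^ s = C / (x / t) `^ s.
    by field; rewrite !gt_eqF.
  by rewrite ler_pdivlMr// mulrC.
have -> : C * x `^ (- s) * (t `^ (s - 1) * f t) = f t * (C * x `^ (- s) * t `^ s) / t.
  by rewrite (powRDp _ _ t0) powR_inv1 ?(ltW t0)//; ring.
apply: ler_wpM2r; first by rewrite invr_ge0 ltW.
exact: ler_wpM2l.
Qed.

Section conv.
Variables (f : R -> R) (c : R) (g : nat -> R -> R).
Hypotheses (kf : is_kernel f) (lg : ladder c g).

Let F j x t := f t * g j (x / t) / t.

Let measurable_F j x : measurable_fun setT (F j x).
Proof.
have [f0 mf _ _] := kf.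
have -> : F j x = (fun t => f t * g j (x * t `^ (-1)) * t `^ (-1)).
  apply/funext => t; rewrite /F; have [t0|t0] := leP t 0.
    by rewrite (f0 _ t0) !mul0r.
  by rewrite (powR_inv1 (ltW t0)).
have mp : measurable_fun setT (fun t : R => t `^ (-1)) by exact: measurable_powR.
apply: measurable_funM => //; apply: measurable_funM => //.
apply: (measurableT_comp (ladder_measurable j lg)).
exact: measurable_funM.
Qed.

Let F_bound j s : 1 < s -> exists2 C, 0 <= C & forall x t, 0 < x ->
  `|F j x t| <= C * x `^ (- s) * (t `^ (s - 1) * f t).
Proof.
move=> s1; have [f0 _ fge0 _] := kf; have [C HC] := ladder_decays lg j s1.
exists C; last by move=> x t; exact: conv_bound.
by apply: le_trans (HC 1 ltr01); rewrite mulr_ge0 ?powR_ge0.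
Qed.

Let integ_F j x : 0 < x -> integ (F j x).
Proof.
move=> x0; have [_ _ _ mf] := kf.
have s1 : 1 < 2 :> R by rewrite ltr1n.
have [C _ HC] := F_bound j s1.
apply: (integ_le (measurable_F j x) (fun t => HC x t x0)).
by apply: integZ; exact: mf.
Qed.

Let mconv_F j x : mconv f (g j) x = rint (F j x).
Proof.
have [f0 _ _ _] := kf.
by apply: (mconvE f0 (ladder_vanish lg j)) => y; exact: integ_F.
Qed.

Let is_derive_F j x t : 0 < x ->
  is_derive x 1 (fun y => F j y t) (((c + j%:R) * F j x t - F j.+1 x t) / x).
Proof.
move=> x0; have [f0 _ _ _] := kf; have [t0|t0] := leP t 0.
  rewrite (_ : (fun y => F j y t) = (fun=> 0)); last first.
    by apply/funext => y; rewrite /F (f0 _ t0) !mul0r.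
  by apply: is_derive_eq (real_derive_cst 0 x) _; rewrite /F (f0 _ t0) !(mul0r,
    mulr0) subr0 mul0r.
have xt : 0 < x / t by rewrite divr_gt0.
have did : is_derive x 1 (fun y : R => t^-1 * y) t^-1.
  by apply: is_derive_eq (real_deriveZ t^-1 (is_derive_id x 1)) _; rewrite mulr1.
have dg := ladder_derive lg j xt.
rewrite [in is_derive _ _ _ _ ](mulrC x) in dg.
have d1 := @real_derive_comp R (g j) (fun y => t^-1 * y) x _ _ dg did.
have -> : (fun y => F j y t) = (fun y => f t / t * g j (t^-1 * y)).
  by apply/funext => y; rewrite /F (mulrC y); ring.
apply: is_derive_eq (real_deriveZ (f t / t) d1) _.
rewrite /F (mulrC x); field.
by rewrite !gt_eqF.
Qed.

(** In the convolution x occurs only inside g_j(x/t), and x d/dx commutes with this dilation; the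
    ladder relation therefore passes under the integral sign. *)
Lemma ladder_mconv : ladder c (fun j => mconv f (g j)).
Proof.
have [f0 mf fge0 sf] := kf.
have s1 : 1 < 2 :> R by rewrite ltr1n.
split=> [j|j x|j x x0|j s ss].
- by apply: (mconv_vanish f0 (ladder_vanish lg j)) => y; exact: integ_F.
- by apply: (mconv_ge0 f0 (ladder_vanish lg j)) => //; [exact: ladder_ge0 lg j|move=> y;
  exact: integ_F].
- have [C C0 HC] := F_bound j s1; have [D D0 HD] := F_bound j.+1 s1.
  have x20 : 0 < x / 2 by rewrite divr_gt0.
  (* Dominates the derivative uniformly for y in ]x/2, 2x[, where y^(-2)/y is largest at the left
     end; the exponent 2 is a choice of s > 1 in [F_bound]. *)
  pose K := (`|c + j%:R| * C + D) * (x / 2) `^ (- 2) / (x / 2).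
  have K0 : 0 <= K.
    apply: divr_ge0; last exact: ltW.
    by apply: mulr_ge0; [apply: addr_ge0 => //; exact: mulr_ge0|exact: powR_ge0].
  pose G t := K * (t `^ (2 - 1) * f t).
  have Ix : `]x / 2, x * 2[%classic x by rewrite /= in_itv/=; apply/andP; split; lra.
  have Ip y : `]x / 2, x * 2[%classic y -> 0 < y.
    by rewrite /= in_itv/= => /andP[h _]; exact: lt_trans h.
  have dF y t : 0 < y -> partial1of2 (F j) y t = ((c + j%:R) * F j y t - F j.+1 y t) / y.
    by move=> y0; rewrite partial1of2E; have [_ ->] := is_derive_F j t y0.
  have h1 y : `]x / 2, x * 2[%classic y -> leb.-integrable setT (EFin \o F j y).
    by move=> /Ip; exact: integ_F.
  have h2 y t : `]x / 2, x * 2[%classic y -> setT t -> derivable (F j ^~ t) y 1.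
    by move=> /Ip y0 _; have [] := is_derive_F j t y0.
  have h3 t : 0 <= G t by rewrite mulr_ge0// mulr_ge0 ?powR_ge0.
  have h4 : leb.-integrable setT (EFin \o G) by apply: (@integZ R K); exact: sf.
  have h5 y t : `]x / 2, x * 2[%classic y -> setT t -> `|partial1of2 (F j) y t| <= G t.
    move=> Iy _; have y0 := Ip y Iy.
    have xy : x / 2 <= y by move: Iy; rewrite /= in_itv/= => /andP[/ltW].
    rewrite (dF y t y0) normrM normfV (gtr0_norm y0).
    have tf : 0 <= t `^ (2 - 1) * f t by rewrite mulr_ge0 ?powR_ge0.
    have yx : y `^ (- 2) <= (x / 2) `^ (- 2).
      by rewrite !powRN lef_pV2 ?posrE ?powR_gt0// ge0_ler_powR// ?nnegrE ltW.
    have e1 : `|(c + j%:R) * F j y t - F j.+1 y t| <=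
        (`|c + j%:R| * C + D) * (x / 2) `^ (- 2) * (t `^ (2 - 1) * f t).
      apply: (le_trans (ler_normB _ _)); rewrite normrM.
      have e2 : `|F j y t| <= C * (x / 2) `^ (- 2) * (t `^ (2 - 1) * f t).
        apply: (le_trans (HC y t y0)); apply: ler_wpM2r => //; exact: ler_wpM2l.
      have e3 : `|F j.+1 y t| <= D * (x / 2) `^ (- 2) * (t `^ (2 - 1) * f t).
        apply: (le_trans (HD y t y0)); apply: ler_wpM2r => //; exact: ler_wpM2l.
      have := ler_wpM2l (normr_ge0 (c + j%:R)) e2; move: e3; lra.
    rewrite /G /K.
    have -> : forall A B : R, A / (x / 2) * B = A * B * (x / 2)^-1 by move=> A B; ring.
    apply: ler_pM => //; first by rewrite invr_ge0 ltW.
    by rewrite lef_pV2 ?posrE.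
  have D1 := derivable_under_integral measurableT Ix h1 h2 h3 h4 h5.
  have D2 := differentiation_under_integral measurableT Ix h1 h2 h3 h4 h5.
  rewrite (funext (mconv_F j)); split; first exact: D1.
  rewrite -derive1E D2 !mconv_F.
  have i0 := integ_F j x0; have i1 := integ_F j.+1 x0.
  rewrite -(rintZ _ i0) -(rintB (integZ _ i0) i1) mulrC.
  rewrite -(rintZ _ (integD (integZ (c + j%:R) i0) (integN i1))).
  by apply: eq_Rintegral => t _; rewrite (dF x t x0) mulrC.
- have [C C0 HC] := F_bound j ss.
  have iM := sf s ss.
  exists (C * rint (fun t => t `^ (s - 1) * f t)) => x x0.
  rewrite mconv_F; have iF := integ_F j x0.
  have h : `|rint (F j x)| <= C * x `^ (- s) * rint (fun t => t `^ (s - 1) * f t).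
    rewrite -(rintZ _ iM); apply: (le_trans (le_normr_Rintegral measurableT iF)).
    by apply: (rint_le (integ_norm iF) (integZ _ iM)) => t; exact: HC.
  have xs : 0 < x `^ s by exact: powR_gt0.
  apply: (le_trans (ler_wpM2l (ltW xs) h)).
  rewrite powRN le_eqVlt; apply/orP; left; apply/eqP; field; exact: lt0r_neq0.
Qed.

Lemma rmellin_ladder_mconv j z : 1 < complex.Re z ->
  rmellin (mconv f (g j)) z = rmellin f z * rmellin (g j) z.
Proof.
have [f0 mf fge0 sf] := kf => z1.
apply: rmellin_mconv => //.
- exact: ladder_vanish lg j.
- exact: ladder_measurable lg.
- exact: ladder_ge0 lg j.
- by move=> x; exact: integ_F.
- exact: sf.
- exact: ladder_mellin_integrable lg z1.
Qed.

End conv.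

Lemma mconvs_rcons f fs (h : R -> R) :
  mconvs (f :: rcons fs h) = mconv f (mconvs (rcons fs h)).
Proof. by case: fs. Qed.

(** The parametrized kernel is innermost in [mconvs]: induction on fs starts from [ladder_gamma] and
    adds one outer convolution at a time. *)
Definition chain (fs : seq (R -> R)) c (j : nat) : R -> R :=
  mconvs (rcons fs (gamma_kernel (c + j%:R))).

Lemma chainP (fs : seq (R -> R)) c : -1 < c ->
  (forall i, (i < size fs)%N -> is_kernel (nth (fun=> 0) fs i)) ->
  ladder c (chain fs c) /\
  forall j z, 1 < complex.Re z ->
    rmellin (chain fs c j) z = (\prod_(f <- fs) rmellin f z) * Gammac (z + (c + j%:R)%:C).
Proof.
move=> c1; elim: fs => [|f fs IH] kfs.
  split; first exact: ladder_gamma.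
  move=> j z z1; rewrite big_nil mul1r; apply: rmellin_gamma_kernel.
  have : 0 <= j%:R :> R by []. lra.
have kf : is_kernel f by exact: (kfs 0%N).
have [l1 m1] := IH (fun i hi => kfs i.+1 hi).
have e : chain (f :: fs) c = (fun j => mconv f (chain fs c j)).
  by apply/funext => j; rewrite /chain rcons_cons mconvs_rcons.
rewrite e; split; first exact: ladder_mconv.
move=> j z z1; rewrite (rmellin_ladder_mconv kf l1)// m1// big_cons mulrA.
by [].
Qed.

End ladders.

(** * The class of functions to which Mellin uniqueness is applied *)

Section tempered.
Context {R : realType}.
Implicit Types (f w : R -> R) (z : R[i]) (k x s : R).

Definition tempered f : Prop :=
  [/\ vanish f, forall x : R, 0 < x -> {for x, continuous f} & decays 1 f].

Lemma tempered_measurable f : tempered f -> measurable_fun setT f.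
Proof. by case=> f0 cf _; exact: measurable_pos. Qed.

Lemma tempered_mellin_integrable f s : tempered f -> 1 < s -> mellin_integrable s f.
Proof.
by move=> nf; have [f0 _ df] := nf; apply: decays_mellin_integrable => //;
  exact: tempered_measurable.
Qed.

Lemma tempered_0 : tempered (fun=> 0 : R).
Proof.
split=> [//|x _|s _]; first exact: cst_continuous.
by exists 0 => x _; rewrite normr0 mulr0.
Qed.

Lemma tempered_D f w : tempered f -> tempered w -> tempered (fun x => f x + w x).
Proof.
move=> [f0 cf df] [w0 cw dw]; split.
- by move=> x x0; rewrite (f0 _ x0) (w0 _ x0) addr0.
- by move=> x x0; apply: continuousD; [exact: cf|exact: cw].
- move=> s s1; have [C HC] := df s s1; have [D HD] := dw s s1.
  exists (C + D) => x x0; apply: le_trans (lerD (HC x x0) (HD x x0)).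
  rewrite -mulrDr; apply: ler_wpM2l; first exact: powR_ge0.
  exact: ler_normD.
Qed.

Lemma tempered_Z k f : tempered f -> tempered (fun x => k * f x).
Proof.
move=> [f0 cf df]; split.
- by move=> x x0; rewrite (f0 _ x0) mulr0.
- move=> x x0; have h : {for x, continuous (fun=> k : R)} by exact: cst_continuous.
  exact: (continuousM h (cf x x0)).
- move=> s s1; have [C HC] := df s s1.
  exists (`|k| * C) => x x0; rewrite normrM mulrCA.
  by apply: ler_wpM2l; [exact: normr_ge0|exact: HC].
Qed.

(** The bound for x f(x) at exponent s is the bound for f at s + 1, again above the threshold. *)
Lemma tempered_mulX f : tempered f -> tempered (fun x => x * f x).
Proof.
move=> [f0 cf df]; split.
- by move=> x x0; rewrite (f0 _ x0) mulr0.
- move=> x x0; have h : {for x, continuous (@id R)} by exact: cvg_id.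
  exact: (continuousM h (cf x x0)).
- move=> s s1; have s2 : 1 < s + 1 by lra.
  have [C HC] := df _ s2.
  exists C => x x0; have := HC x x0.
  by rewrite (powRDp _ _ x0) (powRr1 (ltW x0)) normrM (gtr0_norm x0) mulrA.
Qed.

(** Agreement is asked on x > 0 only, since a normalized form is specified only there. *)
Definition ctempered (F : R -> R[i]) : Prop :=
  exists f w, [/\ tempered f, tempered w & forall x : R, 0 < x -> F x = f x +i* w x].

Lemma ctempered_0 : ctempered (fun=> 0).
Proof. by exists (fun=> 0), (fun=> 0); split; [exact: tempered_0|exact: tempered_0|]. Qed.

Lemma ctempered_D F G : ctempered F -> ctempered G -> ctempered (fun x => F x + G x).
Proof.
move=> [f1 [f2 [n1 n2 e1]]] [g1 [g2 [m1 m2 e2]]].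
exists (fun x => f1 x + g1 x), (fun x => f2 x + g2 x).
by split; [exact: tempered_D|exact: tempered_D|move=> x x0; rewrite e1// e2].
Qed.

Lemma ctempered_sum (I : finType) (F : I -> R -> R[i]) :
  (forall i, ctempered (F i)) -> ctempered (fun x => \sum_i F i x).
Proof.
move=> nF.
have : forall r : seq I, ctempered (fun x => \sum_(i <- r) F i x).
  elim=> [|i r IH].
    by under eq_fun do rewrite big_nil; exact: ctempered_0.
  by under eq_fun do rewrite big_cons; exact: ctempered_D.
by apply.
Qed.

(** Induction by Horner's scheme, from closure under multiplication by x and linear combinations. *)
Lemma ctempered_poly (P : {poly R[i]}) w v : tempered w ->
  (forall x, 0 < x -> v x = w x) -> ctempered (fun x => P.[x%:C] * (v x)%:C).
Proof.
move=> nw vw; elim/poly_ind: P => [|P c [f1 [f2 [n1 n2 e]]]].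
  by under eq_fun do rewrite horner0 mul0r; exact: ctempered_0.
exists (fun x => x * f1 x + complex.Re c * w x), (fun x => x * f2 x + complex.Im c * w x).
split.
- by apply: tempered_D; [exact: tempered_mulX|exact: tempered_Z].
- by apply: tempered_D; [exact: tempered_mulX|exact: tempered_Z].
move=> x x0; rewrite hornerD hornerMX hornerC mulrDl mulrAC (e x x0) (vw x x0).
by case: c => c d; apply/eqP; rewrite eq_complex /=; apply/andP; split; apply/eqP; ring.
Qed.

Lemma ctempered_unique (H : R -> R[i]) : ctempered H ->
  (forall z, complex.Re z = 2 -> mellin H z = 0) ->
  forall x : R, 0 < x -> H x = 0.
Proof.
move=> [f [w [nf nw e]]] hz.
have s1 : 1 < 2 :> R by rewrite ltr1n.
have [f0 cf _] := nf. have [w0 cw _] := nw.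
have mf := tempered_measurable nf. have mw := tempered_measurable nw.
have key (t : R) : rmellin f (2 +i* t) + 'i * rmellin w (2 +i* t) = 0.
  rewrite -(@mellinE _ H f w (2 +i* t) e f0 w0 mf mw (tempered_mellin_integrable nf s1)
    (tempered_mellin_integrable nw s1)).
  exact: hz.
have reE (g : R -> R) t : tempered g -> rmellin g (2 +i* t) =
    rint (fun x => x `^ (2 - 1) * g x * cos (t * ln x)) +i*
    rint (fun x => x `^ (2 - 1) * g x * sin (t * ln x)).
  move=> ng; rewrite /rmellin; congr (_ +i* _); apply: eq_Rintegral => x _.
    by rewrite Re_cpow /= subr0; ring.
  by rewrite Im_cpow /= subr0; ring.
have cosN' (g : R -> R) t : rint (fun x => x `^ (2 - 1) * g x * cos (- t * ln x)) =
    rint (fun x => x `^ (2 - 1) * g x * cos (t * ln x)).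
  by apply: eq_Rintegral => x _; rewrite mulNr cosN.
have sinN' (g : R -> R) t : tempered g -> rint (fun x =>
  x `^ (2 - 1) * g x * sin (- t * ln x)) =
    - rint (fun x => x `^ (2 - 1) * g x * sin (t * ln x)).
  move=> ng; have mg := tempered_measurable ng.
  have := @mellin_integrable_Im R g (2 +i* t) mg (tempered_mellin_integrable ng s1) => ig.
  have ig' : integ (fun x => x `^ (2 - 1) * g x * sin (t * ln x)).
    move: ig; congr integ; apply/funext => x.
    by rewrite Im_cpow /= subr0; ring.
  transitivity (rint (fun x => -1 * (x `^ (2 - 1) * g x * sin (t * ln x)))).
    by apply: eq_Rintegral => x _; rewrite mulNr sinN; ring.
  by rewrite (rintZ _ ig') mulN1r.
(* With A, B, C, D the four integrals, the equation at 2 + it reads A - D = 0 and B + C = 0, and at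
   2 - it it reads A + D = 0 and C - B = 0; together they separate f from w. *)
have split_key t : [/\ rint (fun x => x `^ (2 - 1) * f x * cos (t * ln x)) = 0,
    rint (fun x => x `^ (2 - 1) * f x * sin (t * ln x)) = 0,
    rint (fun x => x `^ (2 - 1) * w x * cos (t * ln x)) = 0 &
    rint (fun x => x `^ (2 - 1) * w x * sin (t * ln x)) = 0].
  have := key t; have := key (- t).
  rewrite !(reE _ _ nf) !(reE _ _ nw) !cosN' (sinN' _ _ nf) (sinN' _ _ nw).
  move: (rint (fun x => x `^ (2 - 1) * f x * cos (t * ln x))) => A.
  move: (rint (fun x => x `^ (2 - 1) * f x * sin (t * ln x))) => B.
  move: (rint (fun x => x `^ (2 - 1) * w x * cos (t * ln x))) => C.
  move: (rint (fun x => x `^ (2 - 1) * w x * sin (t * ln x))) => D.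
  clear => -[h1 h2] [h3 h4]; split; lra.
have fin (g : R -> R) : tempered g ->
    (forall t, rint (fun x => x `^ (2 - 1) * g x * cos (t * ln x)) = 0) ->
    (forall t, rint (fun x => x `^ (2 - 1) * g x * sin (t * ln x)) = 0) ->
    forall x, 0 < x -> g x = 0.
  move=> ng hc hs x x0; have [g0 cg _] := ng.
  have vg : vanish (fun x => x `^ (2 - 1) * g x).
    by move=> y y0; rewrite (g0 _ y0) mulr0.
  have cg' y : 0 < y -> {for y, continuous (fun x => x `^ (2 - 1) * g x)}.
    move=> y0; apply: continuousM; last exact: cg.
    exact: is_derive_continuous (is_derive1_powR (2 - 1) y0).
  have /eqP := mellin_unique (tempered_mellin_integrable ng s1) vg cg' hc hs x0.
  by rewrite mulf_eq0 gt_eqF ?powR_gt0//= => /eqP.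
move=> x x0; rewrite (e x x0).
rewrite (fin f nf (fun t => let: And4 h _ _ _ := split_key t in h)
  (fun t => let: And4 _ h _ _ := split_key t in h) x x0).
by rewrite (fin w nw (fun t => let: And4 _ _ h _ := split_key t in h)
  (fun t => let: And4 _ _ _ h := split_key t in h) x x0).
Qed.

End tempered.

(** * Euler and Rodrigues operators on the span of a ladder *)

Section ladder_span.
Context {R : realType}.
Implicit Types (f F : R -> R) (q : R[i] -> R[i]) (z : R[i]) (k x : R).

(* The second index is the ratio of the Mellin transform to that of g 0. *)
Inductive span (c : R) (g : nat -> R -> R) : (R -> R) -> (R[i] -> R[i]) -> Prop :=
| span_base j : span c g (g j) (fun z => poch (z + c%:C) j)
| span_add f1 q1 f2 q2 : span c g f1 q1 -> span c g f2 q2 ->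
    span c g (fun x => f1 x + f2 x) (fun z => q1 z + q2 z)
| span_scale k f q : span c g f q -> span c g (fun x => k * f x) (fun z => k%:C * q z).

Variables (c : R) (g : nat -> R -> R) (lg : ladder c g).

Lemma span_tempered f q : span c g f q -> tempered f.
Proof.
elim=> [j|f1 q1 f2 q2 _ n1 _ n2|k f1 q1 _ n1]; last 2 first.
- exact: tempered_D.
- exact: tempered_Z.
split; first exact: (ladder_vanish lg).
  by move=> x; exact: ladder_continuous lg.
exact: (ladder_decays lg).
Qed.

(** Phi stands for the product of the Mellin transforms of all kernels but the last; the Pochhammer
    multiplier of g_j comes from Gamma(z + c + j). *)
Lemma span_rmellin (Phi : R[i] -> R[i]) :
  (forall j z, 1 < complex.Re z -> rmellin (g j) z = Phi z * Gammac (z + (c + j%:R)%:C)) ->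
  (forall z, 1 < complex.Re z -> 0 < complex.Re (z + c%:C)) ->
  forall f q, span c g f q -> forall z, 1 < complex.Re z ->
  rmellin f z = q z * (Phi z * Gammac (z + c%:C)).
Proof.
move=> cg hc f q; elim=> [j|f1 q1 f2 q2 s1 IH1 s2 IH2|k f1 q1 s1 IH1] z z1.
- rewrite cg// rmorphD rmorph_nat addrA Gammac_poch; last exact: hc.
  by rewrite mulrCA.
- have n1 := span_tempered s1. have n2 := span_tempered s2.
  rewrite (rmellinD (tempered_measurable n1) (tempered_measurable n2)
    (tempered_mellin_integrable n1 z1) (tempered_mellin_integrable n2 z1)).
  by rewrite IH1// IH2// mulrDl.
- have n1 := span_tempered s1.
  by rewrite (rmellinZ _ (tempered_measurable n1) (tempered_mellin_integrable n1 z1))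
    IH1// mulrA.
Qed.

(** On a base element, (c + j) (z + c)_j - (z + c)_(j+1) = - z (z + c)_j. *)
Lemma span_theta f q : span c g f q -> exists2 f',
  span c g f' (fun z => - z * q z) & forall x, 0 < x -> is_derive x 1 f (f' x / x).
Proof.
elim=> [j|f1 q1 f2 q2 _ [g1 s1 d1] _ [g2 s2 d2]|k f1 q1 _ [g1 s1 d1]].
- exists (fun x => (c + j%:R) * g j x + (-1) * g j.+1 x).
    have := span_add (span_scale (c + j%:R) (span_base c g j)) (span_scale (-1)
      (span_base c g j.+1)).
    congr span; apply/funext => z.
    rewrite poch_S rmorphN rmorph1 rmorphD rmorph_nat; ring.
  move=> x x0; apply: is_derive_eq (ladder_derive lg j x0) _.
  by rewrite mulN1r.
- exists (fun x => g1 x + g2 x).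
    have := span_add s1 s2; congr span; apply/funext => z; ring.
  move=> x x0; rewrite mulrDl; exact: real_deriveD (d1 x x0) (d2 x x0).
- exists (fun x => k * g1 x).
    have := span_scale k s1; congr span; apply/funext => z; ring.
  move=> x x0; rewrite -mulrA; exact: real_deriveZ (d1 x x0).
Qed.

Lemma derive1_local (u v : R -> R) : (forall x, 0 < x -> u x = v x) ->
  forall x, 0 < x -> derive1 u x = derive1 v x.
Proof.
move=> uv x x0; rewrite !derive1E; apply: near_eq_derive.
by near=> y; apply: uv; near: y; exact: lt_nbhsr.
Unshelve. all: by end_near. Qed.

Lemma derive1n_local n (u v : R -> R) : (forall x, 0 < x -> u x = v x) ->
  forall x, 0 < x -> derive1n n u x = derive1n n v x.
Proof.
move=> uv; elim: n => [|n IH] x x0; first exact: uv.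
by rewrite !derive1nS; exact: derive1_local.
Qed.

Lemma span_derive1 f q (u : R -> R) : span c g f q -> (forall x, 0 < x -> u x = f x) ->
  exists2 f', span c g f' (fun z => - z * q z) &
  forall x, 0 < x -> is_derive x 1 u (f' x / x).
Proof.
move=> sf uf; have [f' sf' df'] := span_theta sf; exists f' => // x x0.
apply: near_is_derive (df' x x0).
by near=> y; apply/esym/uf; near: y; exact: lt_nbhsr.
Unshelve. all: by end_near. Qed.

(** Induction on n through the innermost derivative: (y^(b+n+1) f)' = y^(b+n) ((b+n+1) f + theta f),
    whose bracket contributes the last Pochhammer factor b + 1 - z + n. *)
Lemma span_rodrigues b n : forall f q F, span c g f q ->
  (forall x, 0 < x -> F x = f x) ->
  exists2 f', span c g f' (fun z => poch (b%:C + 1 - z) n * q z) &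
  forall x, 0 < x -> rodrigues b n F x = f' x.
Proof.
elim: n => [|n IH] f q F sf Ff.
  exists f.
    by move: sf; congr span; apply/funext => z; rewrite /poch big_ord0 mul1r.
  move=> x x0; rewrite /rodrigues derive1n0 addr0 mulrA -(powRDp _ _ x0) addNr powRr0 mul1r.
  exact: Ff.
have [f1 s1 d1] := span_derive1 sf Ff.
pose F1 x := (b + n.+1%:R) * f x + f1 x.
have sF1 := span_add (span_scale (b + n.+1%:R) sf) s1.
have [f' sf' ef'] := IH _ _ F1 sF1 (fun x _ => erefl).
exists f'.
  move: sf'; congr span; apply/funext => z; rewrite poch_S.
  rewrite -mulrA; congr (_ * _); rewrite rmorphD rmorph_nat -natr1; ring.
move=> x x0; rewrite -(ef' x x0) /rodrigues derive1Sn; congr (_ * _).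
apply: derive1n_local x0 => y y0.
rewrite derive1E.
have [_ ->] := real_deriveM (is_derive1_powR (b + n.+1%:R) y0) (d1 y y0).
rewrite /F1 (Ff y y0).
have -> : b + n.+1%:R - 1 = b + n%:R by rewrite -natr1; ring.
have -> : y `^ (b + n.+1%:R) = y `^ (b + n%:R) * y.
  by rewrite -[X in _ * X](powRr1 (ltW y0)) -(powRDp _ _ y0); congr powR; rewrite -natr1;
    ring.
field; exact: lt0r_neq0.
Qed.

Lemma span_rodrigues_seq (I : Type) (l : seq I) (b : I -> R) (m : I -> nat) f q F :
  span c g f q -> (forall x, 0 < x -> F x = f x) ->
  exists2 f', span c g f' (fun z => (\prod_(i <- l) poch ((b i)%:C + 1 - z) (m i)) * q z) &
  forall x, 0 < x -> foldr (fun i => rodrigues (b i) (m i)) F l x = f' x.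
Proof.
move=> sf Ff; elim: l => [|i l [f1 s1 e1]] /=.
  exists f => //.
  by move: sf; congr span; apply/funext => z; rewrite big_nil mul1r.
have [f' s' e'] := span_rodrigues (b i) (m i) s1 e1.
exists f' => //.
by move: s'; congr span; apply/funext => z; rewrite big_cons mulrA.
Qed.

(** Meant for the weights v_l. The multiplier is left existential because membership in the span
    already gives temperedness. *)
Lemma span_iter_theta f q F l : span c g f q -> (forall x, 0 < x -> F x = f x) ->
  exists f' q', span c g f' q' /\
  forall x, 0 < x -> iter l (fun (h : R -> R) x => - x * derive1 h x) F x = f' x.
Proof.
move=> sf Ff; elim: l => [|l [f1 [q1 [s1 e1]]]]; first by exists f, q.
have [f' s' d'] := span_derive1 s1 e1.
exists (fun x => (-1) * f' x), (fun z => (-1)%:C * (- z * q1 z)).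
split; first exact: span_scale.
move=> x x0; rewrite iterS derive1E; have [_ ->] := d' x x0.
by field; exact: lt0r_neq0.
Qed.

End ladder_span.

Lemma size_map_enum_ord (T : Type) k (f : 'I_k -> T) :
  size [seq f i | i <- enum 'I_k] = k.
Proof. by rewrite size_map size_enum_ord. Qed.

Lemma prod_map_enum_ord (T : Type) (K : comNzRingType) k (f : 'I_k -> T) (G : T -> K) :
  \prod_(x <- [seq f i | i <- enum 'I_k]) G x = \prod_(i < k) G (f i).
Proof. by rewrite big_map big_enum. Qed.

(** * The Laguerre I weights as ladders, and their Mellin transforms *)

Section laguerre_weights.
Context {R : realType} (r s : nat).
Variable a : 'I_(r + s.+1) -> R.
Hypothesis a_gtN1 : forall rho, -1 < a rho.
Implicit Types (b : 'I_r -> R) (z : R[i]).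

(** The factors of w_0 without the last Gamma kernel, whose parameter is [c] below. *)
Definition kernels b : seq (R -> R) :=
  [seq beta_kernel (a (lshift s.+1 h)) (b h) | h <- enum 'I_r]
  ++ [seq gamma_kernel (a (rshift r (widen_ord (leqnSn s) l))) | l <- enum 'I_s].

Let c := a (rshift r ord_max).

Lemma w0_chain b : w0 a b = chain (kernels b) c 0.
Proof.
rewrite /w0 /chain /kernels addr0 rcons_cat; congr (mconvs (_ ++ _)).
by rewrite enum_ordSr map_rcons -map_comp.
Qed.

Lemma kernelsP b : (forall h : 'I_r, a (lshift s.+1 h) < b h) ->
  forall i, (i < size (kernels b))%N -> is_kernel (nth (fun=> 0) (kernels b) i).
Proof.
move=> ab i; rewrite /kernels size_cat nth_cat !size_map_enum_ord => ir.
case: ltnP => [ir'|ri].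
  rewrite (nth_map (Ordinal ir')) ?size_enum_ord//.
  exact: beta_is_kernel.
have is' : (i - r < s)%N by rewrite ltn_subLR.
rewrite (nth_map (Ordinal is')) ?size_enum_ord//.
exact: gamma_is_kernel.
Qed.

Lemma kernels_ladder b : (forall h : 'I_r, a (lshift s.+1 h) < b h) ->
  ladder c (chain (kernels b) c).
Proof. by move=> ab; exact: (proj1 (chainP (a_gtN1 _) (kernelsP ab))). Qed.

Lemma kernels_rmellin b j z : (forall h : 'I_r, a (lshift s.+1 h) < b h) ->
  1 < complex.Re z -> rmellin (chain (kernels b) c j) z =
    (\prod_(f <- kernels b) rmellin f z) * Gammac (z + (c + j%:R)%:C).
Proof. by move=> ab; exact: (proj2 (chainP (a_gtN1 _) (kernelsP ab))). Qed.

Lemma kernels_Gamma b z : (forall h : 'I_r, a (lshift s.+1 h) < b h) ->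
  1 < complex.Re z ->
  (\prod_(f <- kernels b) rmellin f z) * Gammac (z + c%:C) *
    \prod_(h < r) Gammac (z + (b h)%:C) = \prod_(rho < r + s.+1) Gammac (z + (a rho)%:C).
Proof.
move=> ab z1.
have za rho : 0 < complex.Re z + a rho by have := a_gtN1 rho; lra.
rewrite /kernels big_cat !prod_map_enum_ord big_split_ord big_ord_recr /=.
rewrite [X in _ * X * _ * _](eq_bigr
  (fun l : 'I_s => Gammac (z + (a (rshift r (widen_ord (leqnSn s) l)))%:C))); last first.
  by move=> l _; rewrite rmellin_gamma_kernel.
rewrite [RHS](_ : _ = (\prod_(h < r) (rmellin (beta_kernel (a (lshift s.+1 h)) (b h)) z *
    Gammac (z + (b h)%:C))) * (\prod_(l < s) Gammac (z + (a (rshift r (widen_ord (leqnSn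
      s) l)))%:C) *
    Gammac (z + c%:C))); last first.
  congr (_ * _); apply: eq_bigr => h _.
  by rewrite rmellin_beta_kernel.
rewrite big_split /=; ring.
Qed.

End laguerre_weights.

(** * Comparison of both sides on the line Re z = 2 *)

Unset Implicit Arguments.

Theorem theorem5p6 (R : realType) (p r s : nat)
    (a : 'I_(r + s) -> R) (b : 'I_r -> R) (beta : 'I_p -> R)
    (n : 'I_r -> nat) (eta : 'I_s -> nat) (m : 'I_p -> nat)
    (p_ge1 : (1 <= p)%N) (s_ge1 : (1 <= s)%N)
    (a_gtN1 : forall rho, -1 < a rho) (b_gtN1 : forall h, -1 < b h)
    (a_lt_b : forall h : 'I_r, a (lshift s h) < b h)
    (beta_a : forall i rho, -1 < beta i + a rho)
    (adm : laguerre_admissible n eta)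
    (c_neq0 : c_lambda a b n != 0)
    (beta_nint : forall i j, i != j -> beta i - beta j \isn't a Num.int)
    (a_nint : forall rho sigma, rho != sigma ->
       a rho - a sigma \isn't a Num.int)
    (m_size : (\sum_(i < p) m i).+1
              = (\sum_(h < r) n h + \sum_(l < s) eta l)%N)
    (F : R -> R[i])
    (F_normalized : normalized_form a b beta n eta m F)
    (x : R) (x_gt0 : 0 < x) :
  F x = (rodrigues_vec beta m
           (w0 a (fun h => b h + (n h)%:R)) x)%:C.
Proof.
move: F_normalized => [[B [D [_ _ FE]]] _ FM].
clear beta_a adm c_neq0 beta_nint a_nint m_size p_ge1 b_gtN1.
(* Writing s as [s'.+1] isolates the last Gamma kernel, on which the ladder is built. *)
case: s s_ge1 a eta D a_gtN1 a_lt_b FE FM => [//|s'] _ a _ D a1 ab FE FM.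
pose b' h := b h + (n h)%:R.
have ab' h : a (lshift s'.+1 h) < b' h by rewrite (lt_le_trans (ab h))// lerDl.
have lad := kernels_ladder a1.
pose c := a (rshift r ord_max).
(* f represents the right-hand side on x > 0, with the product of Pochhammer symbols as its
   multiplier. *)
have [f sf Gf] := span_rodrigues_seq (lad b' ab') (enum 'I_p) beta m
  (span_base c (chain (kernels a b') c) 0) (F := w0 a b') ltac:(by move=> y _;
    rewrite w0_chain).
rewrite /rodrigues_vec (Gf x x_gt0).
have nf := span_tempered (lad b' ab') sf.
have cF : ctempered F.
  (* Each weight lies in the span of a ladder: w_h in that of b + e_h, v_l in that of b. *)
  have cL : ctempered (laguerre_form a b B D).
    apply: ctempered_D; apply: ctempered_sum.
    - move=> h; rewrite /wh w0_chain.
      have abh j : a (lshift s'.+1 j) < b j + (j == h)%:R by rewrite (lt_le_trans (ab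
        j))// lerDl.
      exact: (ctempered_poly _ (span_tempered (lad _ abh) (span_base c _ 0))).
    - move=> l; have [f1 [q1 [s1 e1]]] := span_iter_theta (lad b ab) l (span_base c _ 0)
        (F := w0 a b) ltac:(by move=> y _; rewrite w0_chain).
      exact: (ctempered_poly _ (span_tempered (lad b ab) s1) e1).
  have [f1 [f2 [n1 n2 e]]] := cL.
  by exists f1, f2; split => // y y0; rewrite (FE y y0) (e y y0).
have [f1 [f2 [n1 n2 e]]] := cF.
pose H y := F y - (f y)%:C.
have HE y : 0 < y -> H y = (f1 y + (-1) * f y) +i* f2 y.
  move=> y0; rewrite /H (e y y0).
  by apply/eqP; rewrite eq_complex /= mulN1r oppr0 addr0 !eqxx.
have nH : tempered (fun y => f1 y + (-1) * f y) by apply: tempered_D => //;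
  exact: tempered_Z.
have cH : ctempered H by exists (fun y => f1 y + (-1) * f y), f2; split.
suff : H x = 0 by rewrite /H => /eqP; rewrite subr_eq0 => /eqP.
apply: (ctempered_unique cH) x_gt0 => z z2.
have z1 : 1 < complex.Re z by rewrite z2 ltr1n.
have zp (u : R) : -1 < u -> 0 < complex.Re z + u by move=> u1; rewrite z2; lra.
have [v1 _ _] := n1. have [v2 _ _] := n2. have [vH _ _] := nH.
have mf := tempered_measurable nf. have m1 := tempered_measurable n1.
have m2 := tempered_measurable n2. have mH := tempered_measurable nH.
have mF : mellin F z = rmellin f1 z + 'i * rmellin f2 z.
  exact: mellinE e v1 v2 m1 m2 (tempered_mellin_integrable n1 z1)
    (tempered_mellin_integrable n2 z1).
rewrite (mellinE HE vH v2 mH m2 (tempered_mellin_integrable nH z1)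
  (tempered_mellin_integrable n2 z1)).
have nf' := tempered_Z (-1) nf.
rewrite (rmellinD m1 (tempered_measurable nf') (tempered_mellin_integrable n1 z1)
  (tempered_mellin_integrable nf' z1)).
rewrite (rmellinZ _ mf (tempered_mellin_integrable nf z1)) addrAC -mF.
rewrite FM; last by move=> rho; exact: zp.
have zc w : 1 < complex.Re w -> 0 < complex.Re (w + c%:C).
  by move=> w1; rewrite raddfD /=; have := a1 (rshift r ord_max); rewrite -/c; lra.
rewrite (span_rmellin (lad b' ab') (fun j w =>
  @kernels_rmellin R r s' a a1 b' j w ab') zc sf z1).
rewrite -(kernels_Gamma a1 ab' z1) -/c big_enum /=.
have eb : \prod_(h < r) Gammac (z + (b' h)%:C) = \prod_(h < r) Gammac (z + (b h)%:C + (n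
  h)%:R).
  by apply: eq_bigr => h _; rewrite rmorphD rmorph_nat addrA.
(* This licenses the division left open in [kernels_Gamma]; the arguments have positive real part as
   b_h + n_h > a_h > -1. *)
have nz : \prod_(h < r) Gammac (z + (b' h)%:C) != 0.
  apply/prodf_neq0 => h _; apply: Gammac_neq0; rewrite raddfD /=.
  apply: zp; exact: lt_trans (a1 (lshift s'.+1 h)) (ab' h).
rewrite -eb mulfK// /poch big_ord0 mulr1 rmorphN rmorph1 mulN1r mulrC subrr.
by [].
Qed.
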